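(* Let $\omega_1,\omega_2$ be regular majorants and let ${\bf i}\in\mathbb S^2$. Then $${}_{\bf i}\Lambda_{\omega_1,\omega_2}(\mathbb D^4)\cap\mathcal{SR}(\mathbb D^4)\ \subset\ G\Lambda_{\omega_1+\omega_2}(\mathbb D^4)\cap\mathcal{SR}(\mathbb D^4)\ \subset\ {}_{\bf i}\Lambda_{\omega_1+\omega_2}(\mathbb D^4)\cap\mathcal{SR}(\mathbb D^4).$$
   Context: $\mathbb H$ is the skew field of quaternions with Euclidean norm $\|\cdot\|$; $\mathbb D^4=\{q\in\mathbb H:\|q\|<1\}$; $\mathbb S^2$ is the set of purely imaginary quaternions of norm $1$ (so ${\bf i}^2=-1$ for ${\bf i}\in\mathbb S^2$). For ${\bf i}\in\mathbb S^2$ put $\mathbb C({\bf i})=\{x+{\bf i}y: x,y\in\mathbb R\}\cong\mathbb C$ and $\mathbb D_{\bf i}=\mathbb D^4\cap\mathbb C({\bf i})$. Regular majorant: a continuous function $\omega:[0,2]\to\mathbb R_+$ with $\omega(0)=0$, $\omega$ increasing, $\omega(t)/t$ decreasing, and such that for some constant $C>0$, $\int_0^x\frac{\omega(t)}{t}dt+x\int_x^2\frac{\omega(t)}{t^2}dt\le C\omega(x)$ for $0<x<2$. $\mathcal{SR}(\mathbb D^4)$ is the set of (left) slice regular functions: real differentiable $f:\mathbb D^4\to\mathbb H$ such that for every ${\bf i}\in\mathbb S^2$, $\frac12\left(\frac{\partial}{\partial x}+{\bf i}\frac{\partial}{\partial y}\right)f(x+{\bf i}y)=0$ on $\mathbb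 D_{\bf i}$. Function classes ($C, C_1,C_2$ denote positive constants depending on $f$ but not on $x,y$): - ${}_{\bf i}\Lambda_\omega(\mathbb D^4)$: all $f:\mathbb D^4\to\mathbb H$ with $\|f(x)-f(y)\|\le C\omega(\|x-y\|)$ for all $x,y\in\mathbb D_{\bf i}$. - ${}_{\bf i}\Lambda_{\omega_1,\omega_2}(\mathbb D^4)$: all $f:\mathbb D^4\to\mathbb H$ such that, writing $f|_{\mathbb D_{\bf i}}=f_1+f_2{\bf j}$ with $f_1,f_2:\mathbb D_{\bf i}\to\mathbb C({\bf i})$ and ${\bf j}\in\mathbb S^2$ orthogonal to ${\bf i}$, one has $\|f_k(x)-f_k(y)\|\le C_k\omega_k(\|x-y\|)$ for all $x,y\in\mathbb D_{\bf i}$, $k=1,2$ (this does not depend on the choice of ${\bf j}$). - $G\Lambda_\omega(\mathbb D^4)$: all $f:\mathbb D^4\to\mathbb H$ with $\|f(x)-f(y)\|\le C\omega(\|x-y\|)$ for all $x,y\in\mathbb D^4$. *)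

(* Defs.v *)
From HB Require Import structures.
From mathcomp Require Import all_boot all_order all_algebra.
From mathcomp Require Import all_classical all_reals all_analysis.
From mathcomp Require Import ring lra.

Set Implicit Arguments.
Unset Strict Implicit.
Unset Printing Implicit Defensive.

Import Order.TTheory GRing.Theory Num.Theory.
Import numFieldNormedType.Exports.

Local Open Scope classical_set_scope.
Local Open Scope ring_scope.

(* [Quaternion a b c d] stands for a + b i + c j + d k. *)
Record quaternion (R : Type) := Quaternion {
  qre : R; qimi : R; qimj : R; qimk : R }.

Definition quaternion_tuple (R : Type) (q : quaternion R) :=
  (qre q, qimi q, qimj q, qimk q).
Definition tuple_quaternion (R : Type) (t : R * R * R * R) :=
  let: (a, b, c, d) := t in Quaternion a b c d.
Lemma quaternion_tupleK (R : Type) :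
  cancel (@quaternion_tuple R) (@tuple_quaternion R).
Proof. by case. Qed.

HB.instance Definition _ (R : eqType) :=
  Equality.copy (quaternion R) (can_type (@quaternion_tupleK R)).
HB.instance Definition _ (R : choiceType) :=
  Choice.copy (quaternion R) (can_type (@quaternion_tupleK R)).

Section QuaternionAlgebra.
Variable R : realType.
Implicit Types (p q r : quaternion R) (s t : R).

Definition qzero : quaternion R := Quaternion 0 0 0 0.
Definition qopp q : quaternion R :=
  Quaternion (- qre q) (- qimi q) (- qimj q) (- qimk q).
Definition qadd p q : quaternion R :=
  Quaternion (qre p + qre q) (qimi p + qimi q)
             (qimj p + qimj q) (qimk p + qimk q).

Lemma qaddA : associative qadd.
Proof. by case=> ? ? ? ? [? ? ? ?] [? ? ? ?]; rewrite /qadd /= !addrA. Qed.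
Lemma qaddC : commutative qadd.
Proof.
by case=> a b c d [x y z w]; rewrite /qadd /=; congr Quaternion; rewrite addrC.
Qed.
Lemma qadd0 : left_id qzero qadd.
Proof. by case=> *; rewrite /qadd /= !add0r. Qed.
Lemma qaddN : left_inverse qzero qopp qadd.
Proof. by case=> *; rewrite /qadd /= !addNr. Qed.

HB.instance Definition _ :=
  GRing.isZmodule.Build (quaternion R) qaddA qaddC qadd0 qaddN.

Definition qone : quaternion R := Quaternion 1 0 0 0.
Definition qmul p q : quaternion R :=
  Quaternion
    (qre p * qre q - qimi p * qimi q - qimj p * qimj q - qimk p * qimk q)
    (qre p * qimi q + qimi p * qre q + qimj p * qimk q - qimk p * qimj q)
    (qre p * qimj q - qimi p * qimk q + qimj p * qre q + qimk p * qimi q)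
    (qre p * qimk q + qimi p * qimj q - qimj p * qimi q + qimk p * qre q).

Lemma qmulA : associative qmul.
Proof.
by case=> ? ? ? ? [? ? ? ?] [? ? ? ?]; rewrite /qmul /=; congr Quaternion; ring.
Qed.
Lemma qmul1l : left_id qone qmul.
Proof. by case=> *; rewrite /qmul /=; congr Quaternion; ring. Qed.
Lemma qmul1r : right_id qone qmul.
Proof. by case=> *; rewrite /qmul /=; congr Quaternion; ring. Qed.
Lemma qmulDl : left_distributive qmul +%R.
Proof. by move=> p q r; congr Quaternion => /=; ring. Qed.
Lemma qmulDr : right_distributive qmul +%R.
Proof. by move=> p q r; congr Quaternion => /=; ring. Qed.
Lemma qone_neq0 : qone != 0.
Proof. by apply/eqP => -[] /eqP; rewrite oner_eq0. Qed.

HB.instance Definition _ := GRing.Zmodule_isNzRing.Build (quaternion R)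
  qmulA qmul1l qmul1r qmulDl qmulDr qone_neq0.

Definition qscale s q : quaternion R :=
  Quaternion (s * qre q) (s * qimi q) (s * qimj q) (s * qimk q).

Lemma qscaleA s t q : qscale s (qscale t q) = qscale (s * t) q.
Proof. by rewrite /qscale /= !mulrA. Qed.
Lemma qscale1 : left_id 1 qscale.
Proof. by case=> *; rewrite /qscale /= !mul1r. Qed.
Lemma qscaleDr : right_distributive qscale +%R.
Proof. by move=> s p q; rewrite /qscale /= !mulrDr. Qed.
Lemma qscaleDl q : {morph qscale^~ q : s t / s + t}.
Proof. by move=> s t; rewrite /qscale /= !mulrDl. Qed.

HB.instance Definition _ := GRing.Zmodule_isLmodule.Build R (quaternion R)
  qscaleA qscale1 qscaleDr qscaleDl.

Lemma qscaleAl s p q : s *: (p * q) = (s *: p) * q.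
Proof. by congr Quaternion => /=; ring. Qed.

HB.instance Definition _ :=
  GRing.Lmodule_isLalgebra.Build R (quaternion R) qscaleAl.

Lemma qscaleAr s p q : s *: (p * q) = p * (s *: q).
Proof. by congr Quaternion => /=; ring. Qed.

HB.instance Definition _ :=
  GRing.Lalgebra_isAlgebra.Build R (quaternion R) qscaleAr.

Definition qdot p q : R :=
  qre p * qre q + qimi p * qimi q + qimj p * qimj q + qimk p * qimk q.
Definition qnorm q : R := Num.sqrt (qdot q q).

Lemma qdot_ge0 q : 0 <= qdot q q.
Proof. by rewrite /qdot -!expr2 !addr_ge0 ?sqr_ge0. Qed.

Lemma qdot_CauchySchwarz p q : qdot p q <= qnorm p * qnorm q.
Proof.
rewrite /qnorm -sqrtrM ?qdot_ge0//; apply: (le_trans (ler_norm _)).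
rewrite -sqrtr_sqr ler_wsqrtr //; case: p q => a b c d [x y z w].
rewrite /qdot /= -subr_ge0 [leRHS](_ : _ =
  (a * y - b * x) ^+ 2 + (a * z - c * x) ^+ 2 + (a * w - d * x) ^+ 2 +
  (b * z - c * y) ^+ 2 + (b * w - d * y) ^+ 2 + (c * w - d * z) ^+ 2); last ring.
by rewrite !addr_ge0 ?sqr_ge0.
Qed.

Lemma ler_qnormD p q : qnorm (p + q) <= qnorm p + qnorm q.
Proof.
have np0 : 0 <= qnorm p by exact: sqrtr_ge0.
have nq0 : 0 <= qnorm q by exact: sqrtr_ge0.
rewrite -ler_sqr ?nnegrE ?addr_ge0 ?sqrtr_ge0//.
rewrite sqrrD !sqr_sqrtr ?qdot_ge0//.
rewrite (_ : qdot (p + q) _ = qdot p p + qdot p q *+ 2 + qdot q q); last first.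
  by rewrite /qdot /=; ring.
by rewrite lerD2r lerD2l lerMn2r qdot_CauchySchwarz orbT.
Qed.

Lemma qnormZ s q : qnorm (s *: q) = `|s| * qnorm q.
Proof.
rewrite /qnorm (_ : qdot _ _ = s ^+ 2 * qdot q q); last by rewrite /qdot /=; ring.
by rewrite sqrtrM ?sqr_ge0// sqrtr_sqr.
Qed.

Lemma qnorm0_eq0 q : qnorm q = 0 -> q = 0.
Proof.
move/eqP; rewrite sqrtr_eq0 => q0.
have {q0} : qdot q q == 0 by rewrite eq_le q0 qdot_ge0.
case: q => a b c d; rewrite /qdot /= -!expr2.
rewrite !paddr_eq0 ?addr_ge0 ?sqr_ge0// !sqrf_eq0.
by move=> /andP[/andP[/andP[/eqP-> /eqP->] /eqP->] /eqP->].
Qed.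

HB.instance Definition _ := Lmodule_isNormed.Build R (quaternion R)
  ler_qnormD qnormZ qnorm0_eq0.

End QuaternionAlgebra.

Section SliceRegularFunctions.
Variable R : realType.
Local Notation H := (quaternion R).
Implicit Types (i j p q : H) (f : H -> H) (w : R -> R).

(* Functions on the open unit ball are represented by total functions on the
   quaternions; the definitions below only depend on their values on the ball. *)
Definition D4 : set H := [set q | `|q| < 1].

Definition S2 : set H := [set q | qre q = 0 /\ `|q| = 1].

Definition Cslice i : set H := [set q | exists x y : R, q = x%:A + y *: i].

Definition Dslice i : set H := D4 `&` Cslice i.

(* Monotonicity is meant in the wide sense. *)
Definition regular_majorant w : Prop :=
  [/\ {within `[0, 2], continuous w} /\ (forall t : R, t \in `[0, 2] -> 0 <= w t),
      w 0 = 0,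
      {in `[0, 2] &, forall s t, s <= t -> w s <= w t},
      {in `]0, 2] &, forall s t, s <= t -> w t / t <= w s / s} &
      exists2 C : R, 0 < C & forall x : R, 0 < x -> x < 2 ->
        (\int[lebesgue_measure]_(t in `]0%R, x]) (w t / t)%:E
         + x%:E * \int[lebesgue_measure]_(t in `[x, 2%R]) (w t / t ^+ 2)%:E
         <= (C * w x)%:E)%E].

Definition slice_regular : set (H -> H) :=
  [set f | (forall q, D4 q -> differentiable f q) /\
    forall i, S2 i -> forall x y : R, D4 (x%:A + y *: i) ->
      2^-1 *: (derive1 (fun s : R => f (s%:A + y *: i)) x
               + i * derive1 (fun t : R => f (x%:A + t *: i)) y) = 0].

Definition slice_Lipschitz i w : set (H -> H) :=
  [set f | exists2 C : R, 0 < C & forall p q, Dslice i p -> Dslice i q ->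
    `|f p - f q| <= C * w `|p - q|].

(* The class does not depend on j: changing j within the unit vectors orthogonal
   to i multiplies f2 by a unit of C(i). *)
Definition slice_Lipschitz2 i w1 w2 : set (H -> H) :=
  [set f | exists j (f1 f2 : H -> H),
    [/\ S2 j /\ qdot i j = 0,
        forall q, Dslice i q ->
          [/\ Cslice i (f1 q), Cslice i (f2 q) & f q = f1 q + f2 q * j],
        slice_Lipschitz i w1 f1 &
        slice_Lipschitz i w2 f2]].

Definition global_Lipschitz w : set (H -> H) :=
  [set f | exists2 C : R, 0 < C & forall p q, D4 p -> D4 q ->
    `|f p - f q| <= C * w `|p - q|].

End SliceRegularFunctions.

Arguments slice_regular {R}.

(* Main.v *)
(**
The heart of the matter is the representation formula
  f(x + y j) = 1/2 (f(x + y i) + f(x - y i)) + 1/2 j i (f(x - y i) - f(x + y i)),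
which expresses f on every slice through its values on the slice of i.  Given
it, |f(p) - f(q)| for p = x + y j, q = x' + y' k with 0 <= y' <= y is bounded by
increments of f on the slice of i at distance at most |p - q|, plus
|j - k| w(2 y') up to a constant; since w(t)/t decreases, the latter is at most
2 w(|j - k| y') <= 2 w(|p - q|).

The representation formula is an instance of unique continuation.  For every
quaternion e, the pair (<f(x + y j), e>, <f(x + y j), j e>) solves the
Cauchy-Riemann equations, and a suitable sum of three such pairs, coming from
the slices of j, i and -i, vanishes on the real axis.  Only differentiability
at each point is available, so Goursat's argument is needed: it provides a
complex primitive F, with a second order Taylor expansion at each point, that
also vanishes on the real axis.  A function with such expansions obeys the
maximum principle, because averaging its squared modulus over the four points
z +- t, z +- i t kills the terms that could be negative.  Applying it to
F(z) / (z + i c)^n on a cap cut out of the upper half plane by a circle centered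
at -i c, and letting n go to infinity, gives F = 0 on the cap.
*)

Require Import Defs.
From mathcomp Require Import all_boot all_order all_algebra.
From mathcomp Require Import all_classical all_reals all_analysis.
From mathcomp Require Import ring lra complex.

Set Implicit Arguments.
Unset Strict Implicit.
Unset Printing Implicit Defensive.

Import Order.TTheory GRing.Theory Num.Theory.
Import numFieldNormedType.Exports.

Local Open Scope classical_set_scope.
Local Open Scope ring_scope.

(** * Integrals of continuous functions compared with affine models *)

Section Primitive.
Variable R : realType.
Implicit Types (f : R -> R) (a b x : R).

(* The base point -2 only has to lie to the left of the unit disc. *)
Definition primitive f x : R := \int[lebesgue_measure]_(t in `[-2, x]) f t.

Lemma primitive_derive f x : continuous f -> -2 < x -> x < 2 ->
  is_derive x 1 (primitive f) (f x).
Proof.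
move=> cf x1 x2.
have fi : lebesgue_measure.-integrable `[-2, 2] (EFin \o f).
  apply: continuous_compact_integrable; first exact: segment_compact.
  exact: continuous_subspaceT.
have [df <-] := continuous_FTC1_closed x2 fi x1 (cf x).
by rewrite derive1E; apply: DeriveDef.
Qed.

Lemma is_derive_quadratic (z k0 k1 x : R) :
  is_derive x 1 (fun t : R => k0 * t + k1 / 2 * (t - z) ^+ 2) (k0 + k1 * (x - z)).
Proof.
rewrite (_ : (fun t => _) =
  (k0 *: id + (k1 / 2) *: (id - cst z) ^+ 2)%R); last first.
  by apply/funext => t; rewrite !fctE.
have dz : is_derive x 1 ((id : R -> R) - cst z) (1 - 0) by exact: is_deriveB.
refine (is_derive_eq (is_deriveD (is_deriveZ k0 (is_derive_id x 1))
  (is_deriveZ (k1 / 2) (is_deriveX 2 dz))) _).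
by rewrite /GRing.scale /= !fctE; field.
Qed.

(** The mean value theorem is applied to [primitive f] minus the antiderivative [Q] of the affine
    model. The endpoints may come in either order, because the increments taken later have no fixed
    sign. *)
Lemma primitive_near_affine f a b z k0 k1 M : continuous f ->
  -2 < a -> a < 2 -> -2 < b -> b < 2 ->
  (forall x, Num.min a b <= x -> x <= Num.max a b ->
    `|f x - (k0 + k1 * (x - z))| <= M) ->
  `|primitive f b - primitive f a
    - (k0 * (b - a) + k1 / 2 * ((b - z) ^+ 2 - (a - z) ^+ 2))| <= M * `|b - a|.
Proof.
move=> cf; wlog ab : a b / a <= b => [H a1 a2 b1 b2 fM|].
  have [ab|/ltW ba] := leP a b; first exact: H.
  have := H _ _ ba b1 b2 a1 a2; rewrite minC maxC => /(_ fM).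
  rewrite (distrC a b); congr (_ <= _); rewrite -normrN; congr Num.norm.
  by rewrite !opprD !opprK; lra.
move=> a1 a2 b1 b2; rewrite min_l // max_r // => fM.
pose Q t := k0 * t + k1 / 2 * (t - z) ^+ 2.
have dPQ x : a <= x -> x <= b ->
    is_derive x 1 (primitive f - Q) (f x - (k0 + k1 * (x - z))).
  move=> ax xb; apply: is_deriveB.
    by apply: primitive_derive => //; lra.
  exact: is_derive_quadratic.
have [||c /itvP cab] := @MVT_segment R (primitive f - Q)
  (fun x => f x - (k0 + k1 * (x - z))) a b ab.
- by move=> x /itvP xab; apply: dPQ; rewrite xab.
- apply: derivable_within_continuous => x /itvP xab.
  by have [] := dPQ x; rewrite ?xab.
rewrite !fctE /Q => E.
rewrite (_ : _ - _ - _ = (f c - (k0 + k1 * (c - z))) * (b - a)); last first.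
  by rewrite -E; ring.
by rewrite normrM ler_wpM2r // fM // cab.
Qed.

End Primitive.

(** * Nested bisection of rectangles *)

Section Bisection.
Variable R : realType.

Lemma nested_segments (u v : nat -> R) :
  (forall n, u n <= u n.+1) -> (forall n, v n.+1 <= v n) ->
  (forall n, u n <= v n) -> exists x, forall n, u n <= x <= v n.
Proof.
move=> /nondecreasing_seqP ndu /nonincreasing_seqP niv uv.
have uvmn m n : u m <= v n.
  apply: le_trans (ndu _ _ (leq_maxl m n)) _.
  exact: le_trans (uv _) (niv _ _ (leq_maxr m n)).
have ub : has_sup (range u).
  by split; [exists (u 0%N), 0%N|exists (v 0%N) => _ [n _ <-]].
exists (sup (range u)) => n; apply/andP; split.
  by apply: sup_upper_bound => //; exists n.
by apply: ge_sup; [case: ub|move=> _ [m _ <-]].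
Qed.

Lemma halving_small (w d : R) : 0 < d -> exists n, w / 2 ^+ n < d.
Proof.
move=> d0; exists (Num.bound `|w / d|).
rewrite ltr_pdivrMr ?exprn_gt0 // mulrC -ltr_pdivrMr //.
apply: le_lt_trans (ler_norm _) _.
apply: lt_trans (archi_boundP (normr_ge0 _)) _.
by rewrite -natrX ltr_nat ltn_expl.
Qed.

(** The compactness half of Goursat's argument, free of estimates. If [P] failed on the rectangle it
    would fail on a quarter of it, and so on; the nested bad rectangles shrink to a point around
    which [P] holds on all small rectangles. *)
Lemma rectangle_bisection (P : R -> R -> R -> R -> Prop) (a b c d : R) :
  a <= b -> c <= d ->
  (forall a' b' c' d' : R, a <= a' <= b' -> b' <= b -> c <= c' <= d' -> d' <= d ->
     let m := (a' + b') / 2 in let n := (c' + d') / 2 in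
     P a' m c' n -> P m b' c' n -> P a' m n d' -> P m b' n d' -> P a' b' c' d') ->
  (forall x y : R, a <= x <= b -> c <= y <= d -> exists2 e : R, 0 < e &
     forall a' b' c' d' : R, a <= a' <= x -> x <= b' <= b -> c <= c' <= y ->
       y <= d' <= d -> b' - a' < e -> d' - c' < e -> P a' b' c' d') ->
  P a b c d.
Proof.
move=> ab cd Pquarter Plocal; apply: contrapT => nP.
pose T := (R * R * R * R)%type.
pose bad (s : T) := let: (a', b', c', d') := s in
  [/\ a <= a' <= b', b' <= b, c <= c' <= d', d' <= d & ~ P a' b' c' d'].
pose sub (s r : T) : Prop := let: (a1, b1, c1, d1) := s in let: (a2, b2, c2, d2) := r in
  [/\ a1 <= a2, b2 <= b1, c1 <= c2 & d2 <= d1] /\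
  (b2 - a2 = (b1 - a1) / 2 /\ d2 - c2 = (d1 - c1) / 2).
(* The successor is asked of every quadruple, with [s] itself as a dummy when it is not bad, so that
   [choice] yields a total function to iterate. *)
have step s : exists r, bad s -> bad r /\ sub s r.
  have [bs|] := pselect (bad s); last by exists s.
  move: s bs => [[[a' b'] c'] d'] [/andP[h1 h2] h3 /andP[h4 h5] h6 nP'].
  set m := (a' + b') / 2; set n := (c' + d') / 2.
  have [P1|P1] := pselect (P a' m c' n); last first.
    exists (a', m, c', n) => _; split; first split => //; rewrite /m /n; try lra.
    by do ![split|lra].
  have [P2|P2] := pselect (P m b' c' n); last first.
    exists (m, b', c', n) => _; split; first split => //; rewrite /m /n; try lra.
    by do ![split|lra].
  have [P3|P3] := pselect (P a' m n d'); last first.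
    exists (a', m, n, d') => _; split; first split => //; rewrite /m /n; try lra.
    by do ![split|lra].
  have [P4|P4] := pselect (P m b' n d'); last first.
    exists (m, b', n, d') => _; split; first split => //; rewrite /m /n; try lra.
    by do ![split|lra].
  by case: nP'; apply: Pquarter => //; rewrite ?h1 ?h4.
have [g gP] := choice step.
pose S k := iter k g (a, b, c, d).
have Sbad k : bad (S k).
  elim: k => [|k IH]; last by have [] := gP _ IH.
  by split => //; rewrite ?lexx ?ab ?cd.
have Ssub k : sub (S k) (S k.+1) by have [] := gP _ (Sbad k).
pose A k := (S k).1.1.1; pose B k := (S k).1.1.2.
pose C k := (S k).1.2; pose D k := (S k).2.
have SE k : S k = (A k, B k, C k, D k) by rewrite /A /B /C /D; case: (S k) => [[[]]].
have step1 k : [/\ A k <= A k.+1, B k.+1 <= B k, C k <= C k.+1 & D k.+1 <= D k].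
  by have := Ssub k; rewrite !SE => -[].
have step2 k : B k - A k = (b - a) / 2 ^+ k /\ D k - C k = (d - c) / 2 ^+ k.
  elim: k => [|k [IH1 IH2]]; first by rewrite expr0 !divr1.
  have := Ssub k; rewrite !SE => -[_ [-> ->]].
  by rewrite IH1 IH2 exprS invfM; split; ring.
have inv k : [/\ a <= A k <= B k, B k <= b, c <= C k <= D k, D k <= d &
  ~ P (A k) (B k) (C k) (D k)] by have := Sbad k; rewrite SE.
have [x xP] : exists x, forall n, A n <= x <= B n.
  by apply: nested_segments => k; [have [] := step1 k|have [] := step1 k|
    have [/andP[]] := inv k].
have [y yP] : exists y, forall n, C n <= y <= D n.
  by apply: nested_segments => k; [have [] := step1 k|have [] := step1 k|
    have [_ _ /andP[]] := inv k].
have [e e0 eP] := Plocal x y (xP 0%N) (yP 0%N).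
have [n nP1] := halving_small (Num.max (b - a) (d - c)) e0.
have [/andP[h1 h2] h3 /andP[h4 h5] h6] := inv n; apply.
have [/andP[h7 h8] /andP[h9 h10]] := (xP n, yP n).
have [E1 E2] := step2 n.
have p0 : 0 < (2 ^+ n)^-1 :> R by rewrite invr_gt0 exprn_gt0.
apply: eP; rewrite ?h1 ?h3 ?h4 ?h6 ?h7 ?h8 ?h9 ?h10 //.
  by rewrite E1; apply: le_lt_trans nP1; rewrite ler_pM2r // le_max lexx.
by rewrite E2; apply: le_lt_trans nP1; rewrite ler_pM2r // le_max lexx orbT.
Qed.

End Bisection.

(** * Goursat's theorem for differentiable closed 1-forms on rectangles *)

Section Goursat.
Variable R : realType.
Implicit Types (p q f : R -> R -> R) (a b c d x y : R).

Definition has_gradient f x y (f1 f2 : R) := forall e : R, 0 < e ->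
  exists2 r : R, 0 < r & forall x' y', `|x' - x| < r -> `|y' - y| < r ->
    `|f x' y' - (f x y + f1 * (x' - x) + f2 * (y' - y))|
      <= e * (`|x' - x| + `|y' - y|).

(** Closedness of p dx + q dy at the point is the sharing of [p2], which is both dp/dy and dq/dx. *)
Definition closed_form_at p q x y := exists p1 p2 q2 : R,
  has_gradient p x y p1 p2 /\ has_gradient q x y p2 q2.

(** The integral of p dx + q dy counterclockwise around the rectangle. Written with primitives, it
    also makes sense for reversed sides, with a change of sign. *)
Definition circulation p q a b c d : R :=
  (primitive (p^~ c) b - primitive (p^~ c) a) +
  (primitive (q b) d - primitive (q b) c) -
  (primitive (p^~ d) b - primitive (p^~ d) a) -
  (primitive (q a) d - primitive (q a) c).

Lemma primitive_edge (f : R -> R) (z k0 k1 M : R) a b : continuous f -> a <= b ->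
  -2 < a -> b < 2 ->
  (forall x, a <= x -> x <= b -> `|f x - (k0 + k1 * (x - z))| <= M) ->
  `|primitive f b - primitive f a
    - (k0 * (b - a) + k1 / 2 * ((b - z) ^+ 2 - (a - z) ^+ 2))| <= M * (b - a).
Proof.
move=> cf ab a2 b2 fM; rewrite -[X in _ <= _ * X]ger0_norm ?subr_ge0 //.
apply: primitive_near_affine => //; [exact: le_lt_trans b2|exact: lt_le_trans ab|].
by rewrite min_l // max_r.
Qed.

(** The affine parts of [p] and [q] form an exact differential, since they share [p2], and their
    circulation is zero. The rest is at most e / 4 times s + t, for sides s and t, on a boundary of
    length 2 (s + t); and (s + t)^2 <= 2 (s^2 + t^2). *)
Lemma circulation_local p q x y e : (forall y, continuous (p^~ y)) ->
  (forall x, continuous (q x)) -> closed_form_at p q x y -> 0 < e ->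
  exists2 r : R, 0 < r & forall a b c d, a <= x <= b -> c <= y <= d ->
    -2 < a -> b < 2 -> -2 < c -> d < 2 -> b - a < r -> d - c < r ->
    `|circulation p q a b c d| <= e * ((b - a) ^+ 2 + (d - c) ^+ 2).
Proof.
move=> cp cq [p1 [p2 [q2 [Dp Dq]]]] e0.
have e4 : 0 < e / 4 by rewrite divr_gt0.
have [r1 r10 P1] := Dp _ e4; have [r2 r20 P2] := Dq _ e4.
exists (Num.min r1 r2); first by rewrite lt_min r10.
move=> a b c d /andP[ax xb] /andP[cy yd] a2 b2 c2 d2.
rewrite !lt_min => /andP[w1 w2] /andP[h1 h2].
have ab := le_trans ax xb; have cd := le_trans cy yd.
have ax' u : a <= u -> u <= b -> `|u - x| <= b - a by rewrite ler_norml; lra.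
have cy' v : c <= v -> v <= d -> `|v - y| <= d - c by rewrite ler_norml; lra.
pose M := e / 4 * ((b - a) + (d - c)).
have pM u v : a <= u -> u <= b -> c <= v -> v <= d ->
    `|p u v - (p x y + p2 * (v - y) + p1 * (u - x))| <= M.
  move=> au ub cv vd; rewrite addrAC; apply: le_trans (P1 _ _ _ _) _.
  - exact: le_lt_trans (ax' _ au ub) w1.
  - exact: le_lt_trans (cy' _ cv vd) h1.
  - by rewrite ler_pM2l // lerD // (ax', cy').
have qM u v : a <= u -> u <= b -> c <= v -> v <= d ->
    `|q u v - (q x y + p2 * (u - x) + q2 * (v - y))| <= M.
  move=> au ub cv vd; apply: le_trans (P2 _ _ _ _) _.
  - exact: le_lt_trans (ax' _ au ub) w2.
  - exact: le_lt_trans (cy' _ cv vd) h2.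
  - by rewrite ler_pM2l // lerD // (ax', cy').
have E1 := primitive_edge (cp c) ab a2 b2 (fun u au ub => pM u c au ub (lexx c) cd).
have E2 := primitive_edge (cq b) cd c2 d2 (fun v cv vd => qM b v ab (lexx b) cv vd).
have E3 := primitive_edge (cp d) ab a2 b2 (fun u au ub => pM u d au ub cd (lexx d)).
have E4 := primitive_edge (cq a) cd c2 d2 (fun v cv vd => qM a v (lexx a) ab cv vd).
have -> : circulation p q a b c d =
  (primitive (p^~ c) b - primitive (p^~ c) a - ((p x y + p2 * (c - y)) * (b - a) +
     p1 / 2 * ((b - x) ^+ 2 - (a - x) ^+ 2))) +
  (primitive (q b) d - primitive (q b) c - ((q x y + p2 * (b - x)) * (d - c) +
     q2 / 2 * ((d - y) ^+ 2 - (c - y) ^+ 2))) -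
  (primitive (p^~ d) b - primitive (p^~ d) a - ((p x y + p2 * (d - y)) * (b - a) +
     p1 / 2 * ((b - x) ^+ 2 - (a - x) ^+ 2))) -
  (primitive (q a) d - primitive (q a) c - ((q x y + p2 * (a - x)) * (d - c) +
     q2 / 2 * ((d - y) ^+ 2 - (c - y) ^+ 2))).
  by rewrite /circulation; ring.
apply: le_trans (ler_normB _ _) _; apply: le_trans (lerD (ler_normB _ _) E4) _.
apply: le_trans (lerD (lerD (ler_normD _ _) E3) (lexx _)) _.
apply: le_trans (lerD (lerD (lerD E1 E2) (lexx _)) (lexx _)) _.
rewrite -subr_ge0 /M [leRHS](_ : _ = e / 2 * ((b - a) - (d - c)) ^+ 2); last by field.
by rewrite mulr_ge0 ?sqr_ge0 // ltW // divr_gt0.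
Qed.

Lemma circulation_quarter p q a b c d m n :
  circulation p q a b c d = circulation p q a m c n + circulation p q m b c n +
    circulation p q a m n d + circulation p q m b n d.
Proof. by rewrite /circulation; ring. Qed.

(** The bound e (s^2 + t^2), for sides s and t, is the sum of the same bounds over the four
    quarters, so it passes from the quarters to the rectangle. Bisection extends it from small
    rectangles to the whole one, and e is arbitrary. *)
Lemma goursat_ordered p q a b c d : (forall y, continuous (p^~ y)) ->
  (forall x, continuous (q x)) -> -2 < a -> b < 2 -> -2 < c -> d < 2 ->
  a <= b -> c <= d ->
  (forall x y, a <= x <= b -> c <= y <= d -> closed_form_at p q x y) ->
  circulation p q a b c d = 0.
Proof.
move=> cp cq a2 b2 c2 d2 ab cd cl; apply/eqP; rewrite -normr_le0.
suff H e : 0 < e ->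
    `|circulation p q a b c d| <= e * ((b - a) ^+ 2 + (d - c) ^+ 2).
  set S := (b - a) ^+ 2 + (d - c) ^+ 2 in H.
  have S0 : 0 <= S by rewrite addr_ge0 ?sqr_ge0.
  apply/ler_addgt0Pr => e e0; rewrite add0r.
  have S1 : 0 < S + 1 by lra.
  apply: le_trans (H (e / (S + 1)) _) _; first by rewrite divr_gt0.
  rewrite mulrAC ler_pdivrMr // ler_pM2l //; lra.
move=> e0; apply: (rectangle_bisection (P := fun a b c d =>
  `|circulation p q a b c d| <= e * ((b - a) ^+ 2 + (d - c) ^+ 2))) => //.
  move=> a' b' c' d' _ _ _ _ m n P1 P2 P3 P4.
  rewrite (circulation_quarter _ _ _ _ _ _ m n).
  apply: le_trans (ler_normD _ _) _; apply: le_trans (lerD (ler_normD _ _) P4) _.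
  apply: le_trans (lerD (lerD (ler_normD _ _) P3) (lexx _)) _.
  apply: le_trans (lerD (lerD (lerD P1 P2) (lexx _)) (lexx _)) _.
  by rewrite /m /n le_eqVlt; apply/orP; left; apply/eqP; field.
move=> x y xab ycd; have [r r0 H] := circulation_local cp cq (cl _ _ xab ycd) e0.
exists r => // a' b' c' d' /andP[h1 h2] /andP[h3 h4] /andP[h5 h6] /andP[h7 h8] w h.
by apply: H => //; rewrite ?h2 ?h6 //; lra.
Qed.

Lemma goursat p q a b c d : (forall y, continuous (p^~ y)) ->
  (forall x, continuous (q x)) ->
  -2 < a < 2 -> -2 < b < 2 -> -2 < c < 2 -> -2 < d < 2 ->
  (forall x y, Num.min a b <= x <= Num.max a b -> Num.min c d <= y <= Num.max c d ->
    closed_form_at p q x y) ->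
  circulation p q a b c d = 0.
Proof.
move=> cp cq; wlog ab : a b / a <= b => [H a2 b2 c2 d2 cl|].
  have [ab|/ltW ba] := leP a b; first exact: H.
  have := H _ _ ba b2 a2 c2 d2; rewrite minC maxC => /(_ cl).
  by move/(congr1 -%R); rewrite oppr0 => <-; rewrite /circulation; ring.
wlog cd : c d / c <= d => [H a2 b2 c2 d2 cl|].
  have [cd|/ltW dc] := leP c d; first exact: H.
  have := H _ _ dc a2 b2 d2 c2; rewrite (minC d) (maxC d) => /(_ cl).
  by move/(congr1 -%R); rewrite oppr0 => <-; rewrite /circulation; ring.
move=> /andP[a2 _] /andP[_ b2] /andP[c2 _] /andP[_ d2].
rewrite !min_l // !max_r // => cl; exact: goursat_ordered.
Qed.

End Goursat.

(** * Second order expansion of the potential of a closed form *)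

Section Potential.
Variable R : realType.
Implicit Types (a b x y e : R).

Lemma sqr_le_between a b x : Num.min a b <= x <= Num.max a b ->
  x ^+ 2 <= a ^+ 2 \/ x ^+ 2 <= b ^+ 2.
Proof.
rewrite ge_min le_max => /andP[/orP[?|?] /orP[?|?]].
- by left; rewrite (_ : x = a) //; lra.
- by have [?|?] := leP 0 x; [right|left]; nra.
- by have [?|?] := leP 0 x; [left|right]; nra.
- by right; rewrite (_ : x = b) //; lra.
Qed.

Lemma dist_le_between a b x : Num.min a b <= x <= Num.max a b ->
  `|x - a| <= `|b - a|.
Proof.
rewrite ge_min le_max => /andP[/orP h1 /orP h2].
have [ab|ba] := leP a b.
  by rewrite [leRHS]ger0_norm ?subr_ge0 // ler_norml; case: h1; case: h2; lra.
by rewrite [leRHS]ltr0_norm ?subr_lt0 // ler_norml; case: h1; case: h2; lra.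
Qed.

(** The integral of p dx + q dy along the vertical segment from the real axis. When [p] vanishes on
    that axis, a path from a fixed base point would gain nothing on its horizontal leg. *)
Definition potential (p q : R -> R -> R) x y : R :=
  primitive (q x) y - primitive (q x) 0.

(** Goursat on the rectangle between (x, 0) and (x', y), whose bottom edge contributes nothing,
    turns the increment of the potential into an integral of [p] from (x, y) to (x', y) followed by
    one of [q] up to (x', y'). First order models of [p] and [q] then give a second order model of
    the potential. *)
Lemma potential_taylor (p q : R -> R -> R) (rho : R) x y (p1 p2 q2 e : R) :
  (forall y, continuous (p^~ y)) -> (forall x, continuous (q x)) ->
  0 < rho -> rho <= 1 ->
  (forall x y, x ^+ 2 + y ^+ 2 < rho ^+ 2 -> closed_form_at p q x y) ->
  (forall x, x ^+ 2 < rho ^+ 2 -> p x 0 = 0) ->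
  x ^+ 2 + y ^+ 2 < rho ^+ 2 ->
  has_gradient p x y p1 p2 -> has_gradient q x y p2 q2 -> 0 < e ->
  exists2 r : R, 0 < r & forall x' y', `|x' - x| < r -> `|y' - y| < r ->
    `|potential p q x' y' - (potential p q x y
       + (p x y * (x' - x) + q x y * (y' - y))
       + (p1 / 2 * (x' - x) ^+ 2 + p2 * ((x' - x) * (y' - y))
          + q2 / 2 * (y' - y) ^+ 2))|
      <= e * (`|x' - x| + `|y' - y|) ^+ 2.
Proof.
move=> cp cq rho0 rho1 cl p0 xy Dp Dq e0.
have [r1 r10 P1] := Dp _ e0; have [r2 r20 P2] := Dq _ e0.
have rr1 : rho ^+ 2 <= 1 by rewrite expr_le1 // ltW.
have x2 : -1 < x < 1.
  by rewrite -ltr_norml -sqrtr_sqr -[ltRHS]sqrtr1 ltr_sqrt //; nra.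
have y2 : -1 < y < 1.
  by rewrite -ltr_norml -sqrtr_sqr -[ltRHS]sqrtr1 ltr_sqrt //; nra.
(* As |x| < 1 and d <= 1, a shift of x by less than d raises x^2 by less than 3 d, so (x', y) stays
   in the disc. *)
pose d := (rho ^+ 2 - (x ^+ 2 + y ^+ 2)) / 3.
have d0 : 0 < d by rewrite divr_gt0 // subr_gt0.
exists (Num.min (Num.min r1 r2) (Num.min d (1 - `|y|))).
  by rewrite !lt_min r10 r20 d0 subr_gt0 ltr_norml.
move=> x' y'; rewrite !lt_min => /andP[/andP[s1 s2] /andP[s3 _]].
move=> /andP[/andP[t1 t2] /andP[t3 t4]].
have d1 : d <= 1 by rewrite /d; nra.
have x'y : x' ^+ 2 + y ^+ 2 < rho ^+ 2.
  by move: s3; rewrite ltr_norml => /andP[l1 l2]; rewrite /d in l1 l2 d1; nra.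
have x'2 : -1 < x' < 1.
  by rewrite -ltr_norml -sqrtr_sqr -[ltRHS]sqrtr1 ltr_sqrt //; nra.
have y'2 : -1 < y' < 1.
  rewrite -ltr_norml -(subrK y y'); apply: le_lt_trans (ler_normD _ _) _.
  by rewrite -ltrBrDr.
have hull (u v : R) : Num.min x x' <= u <= Num.max x x' ->
    Num.min 0 y <= v <= Num.max 0 y -> u ^+ 2 + v ^+ 2 < rho ^+ 2.
  move=> ux vy; have : v ^+ 2 <= y ^+ 2.
    by case: (sqr_le_between vy) => // /le_trans-> //; rewrite expr0n sqr_ge0.
  by clear -ux xy x'y; case: (sqr_le_between ux); lra.
have wide (t : R) : -1 < t < 1 -> -2 < t /\ t < 2 by lra.
have [[xl xr] [yl yr]] := (wide _ x2, wide _ y2).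
have [[xl' xr'] [yl' yr']] := (wide _ x'2, wide _ y'2).
have : circulation p q x x' 0 y = 0.
  apply: goursat => //; rewrite ?xl ?xr ?yl ?yr ?xl' ?xr' ?oppr_lt0 ?ltr0n //.
  by move=> u v ux vy; apply: cl; exact: hull.
have bottom : primitive (p^~ 0) x' - primitive (p^~ 0) x = 0.
  apply/eqP; rewrite -normr_le0.
  have := @primitive_near_affine _ (p^~ 0) x x' 0 0 0 0 (cp 0).
  rewrite !mul0r !addr0 subr0; apply=> // u u1 u2.
  rewrite mul0r addr0 subr0 p0 ?normr0 //.
  have := hull u 0; rewrite expr0n addr0; apply; first by rewrite u1.
  by rewrite ge_min le_max lexx.
rewrite /circulation bottom => E.
have A : `|primitive (p^~ y) x' - primitive (p^~ y) x
    - (p x y * (x' - x) + p1 / 2 * ((x' - x) ^+ 2 - (x - x) ^+ 2))|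
    <= e * (`|x' - x| + `|y' - y|) * `|x' - x|.
  apply: primitive_near_affine => //.
  move=> u u1 u2; have ux : `|u - x| <= `|x' - x|.
    by apply: dist_le_between; rewrite u1.
  have := P1 u y; rewrite subrr normr0 mulr0 !addr0 => /(_ _ r10) H.
  apply: le_trans (H _) _; first exact: le_lt_trans s1.
  by rewrite ler_pM2l // ler_wpDr.
have B : `|primitive (q x') y' - primitive (q x') y
    - ((q x y + p2 * (x' - x)) * (y' - y) + q2 / 2 * ((y' - y) ^+ 2 - (y - y) ^+ 2))|
    <= e * (`|x' - x| + `|y' - y|) * `|y' - y|.
  apply: primitive_near_affine => //.
  move=> v v1 v2; have vy : `|v - y| <= `|y' - y|.
    by apply: dist_le_between; rewrite v1.
  apply: le_trans (P2 _ _ s2 _) _; first exact: le_lt_trans t2.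
  by rewrite ler_pM2l // lerD2l.
rewrite [leRHS](_ : _ = e * (`|x' - x| + `|y' - y|) * `|x' - x| +
  e * (`|x' - x| + `|y' - y|) * `|y' - y|); last by ring.
apply: le_trans (lerD A B).
apply: le_trans (ler_normD _ _); rewrite le_eqVlt; apply/orP; left; apply/eqP.
congr Num.norm; rewrite /potential; move: E; clear; lra.
Qed.

End Potential.

(** * Complex second order expansions and their products *)

Section ComplexTaylor.
Variable R : realType.
Local Notation C := (complex R).
Implicit Types (z : R * R) (a b c w : C).

(** The l1 norm serves for error estimates: it is submultiplicative and free of square roots. The
    maximum principle uses the squared modulus [sqmod], which is multiplicative and polynomial. *)
Definition taxi (w : C) : R := `|complex.Re w| + `|complex.Im w|.
Definition sqmod (w : C) : R := complex.Re w ^+ 2 + complex.Im w ^+ 2.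
Definition cplx (z : R * R) : C := Complex z.1 z.2.

Lemma complex_addE (x y x' y' : R) :
  Complex x y + Complex x' y' = Complex (x + x') (y + y') :> C.
Proof. by []. Qed.

Lemma complex_mulE (x y x' y' : R) :
  Complex x y * Complex x' y' = Complex (x * x' - y * y') (x * y' + y * x') :> C.
Proof. by []. Qed.

Lemma complex_oppE (x y : R) : - Complex x y = Complex (- x) (- y) :> C.
Proof. by []. Qed.

Lemma complex_subE (x y x' y' : R) :
  Complex x y - Complex x' y' = Complex (x - x') (y - y') :> C.
Proof. by []. Qed.

Lemma complex_expr2E (x y : R) :
  Complex x y ^+ 2 = Complex (x ^+ 2 - y ^+ 2) (x * y *+ 2) :> C.
Proof. by rewrite expr2 complex_mulE; congr Complex; ring. Qed.

Lemma taxi_ge0 w : 0 <= taxi w. Proof. by rewrite addr_ge0. Qed.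

Lemma taxi0 : taxi 0 = 0. Proof. by rewrite /taxi /= normr0 addr0. Qed.

Lemma taxi_eq0 w : taxi w = 0 -> w = 0.
Proof.
case: w => x y; rewrite /taxi /= => /eqP.
by rewrite paddr_eq0 // !normr_eq0 => /andP[/eqP -> /eqP ->].
Qed.

Lemma taxiD w1 w2 : taxi (w1 + w2) <= taxi w1 + taxi w2.
Proof.
case: w1 w2 => [x y] [x' y']; rewrite complex_addE /taxi /= addrACA.
by rewrite lerD // ler_normD.
Qed.

Lemma taxiN w : taxi (- w) = taxi w.
Proof. by case: w => x y; rewrite complex_oppE /taxi /= !normrN. Qed.

Lemma taxiM w1 w2 : taxi (w1 * w2) <= taxi w1 * taxi w2.
Proof.
case: w1 w2 => [x y] [x' y']; rewrite complex_mulE /taxi /=.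
apply: le_trans (lerD (ler_normB _ _) (ler_normD _ _)) _.
by rewrite !normrM le_eqVlt; apply/orP; left; apply/eqP; ring.
Qed.

(** The left side is (|x| + |y|)^2 / (x^2 + y^2), which replaces the exact value 1 available for the
    modulus. At 0 the inverse is 0 and the product vanishes. *)
Lemma taxiV w : taxi w^-1 * taxi w <= 2.
Proof.
case: w => x y; have [->|nz] := eqVneq (Complex x y) 0.
  by rewrite invr0 /taxi /= normr0 !addr0 mul0r.
have n0 : 0 < x ^+ 2 + y ^+ 2.
  rewrite lt_neqAle addr_ge0 ?sqr_ge0 // andbT eq_sym.
  by rewrite paddr_eq0 ?sqr_ge0 // !sqrf_eq0; move: nz; rewrite eq_complex.
rewrite /taxi /= normrN !normrM !normfV (ger0_norm (ltW n0)) -mulrDl.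
rewrite mulrAC ler_pdivrMr // -[x ^+ 2]real_normK ?num_real //.
rewrite -[y ^+ 2]real_normK ?num_real // -subr_ge0.
by rewrite [leRHS](_ : _ = (`|x| - `|y|) ^+ 2) ?sqr_ge0 //; ring.
Qed.

Lemma sqmod_ge0 w : 0 <= sqmod w. Proof. by rewrite addr_ge0 ?sqr_ge0. Qed.

Lemma sqmodM w1 w2 : sqmod (w1 * w2) = sqmod w1 * sqmod w2.
Proof.
by case: w1 w2 => [x y] [x' y']; rewrite complex_mulE /sqmod /=; ring.
Qed.

Lemma sqmod_eq0 w : sqmod w = 0 -> w = 0.
Proof.
case: w => x y; rewrite /sqmod /= => /eqP.
by rewrite paddr_eq0 ?sqr_ge0 // !sqrf_eq0 => /andP[/eqP -> /eqP ->].
Qed.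

Lemma sqmod_perturb w1 w2 : sqmod w1 - 2 * (taxi w1 * taxi w2) <= sqmod (w1 + w2).
Proof.
case: w1 w2 => [x y] [x' y']; rewrite complex_addE /taxi /sqmod /= lerBlDr.
have h1 : - (x * x') <= `|x| * `|x'| by rewrite -normrM -normrN ler_norm.
have h2 : - (y * y') <= `|y| * `|y'| by rewrite -normrM -normrN ler_norm.
have := sqr_ge0 x'; have := sqr_ge0 y'.
have := mulr_ge0 (normr_ge0 x) (normr_ge0 y').
have := mulr_ge0 (normr_ge0 y) (normr_ge0 x').
by move: h1 h2; clear; move: `|x| `|y| `|x'| `|y'| => X Y X' Y'; lra.
Qed.

Lemma near_pairP z (P : set (R * R)) : (\forall t \near z, P t) <->
  exists2 r : R, 0 < r & forall x y, `|x - z.1| < r -> `|y - z.2| < r -> P (x, y).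
Proof.
split=> [/nbhs_ballP[r /= r0 H]|[r r0 H]]; first exists r => //.
  by move=> x y hx hy; apply: H; split => /=; rewrite /ball /= distrC.
apply/nbhs_ballP; exists r => // -[x y] [/= hx hy].
by apply: H; rewrite distrC.
Qed.

Definition vanishes_at (F : R * R -> C) z :=
  forall e : R, 0 < e -> \forall t \near z, taxi (F t) <= e.

Definition bounded_at (F : R * R -> C) z :=
  exists M : R, \forall t \near z, taxi (F t) <= M.

(** A Peano expansion: the remainder is a multiple of the squared increment with a factor [eta] that
    tends to 0, a form that is stable under products. *)
Definition taylor2_at (F : R * R -> C) z c1 c2 :=
  exists2 eta, vanishes_at eta z & \forall t \near z,
    F t = F z + c1 * (cplx t - cplx z) + c2 * (cplx t - cplx z) ^+ 2
          + eta t * (cplx t - cplx z) ^+ 2.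

Lemma vanishes_bounded F z : vanishes_at F z -> bounded_at F z.
Proof. by move=> vF; exists 1; apply: vF. Qed.

Lemma vanishesD F G z : vanishes_at F z -> vanishes_at G z ->
  vanishes_at (fun t => F t + G t) z.
Proof.
move=> vF vG e e0; have e2 : 0 < e / 2 by rewrite divr_gt0.
apply: filterS2 (vF _ e2) (vG _ e2) => t h1 h2.
by apply: le_trans (taxiD _ _) _; rewrite [e]splitr lerD.
Qed.

Lemma vanishesM F G z : vanishes_at F z -> bounded_at G z ->
  vanishes_at (fun t => F t * G t) z.
Proof.
move=> vF [M bG] e e0; have M0 : 0 < `|M| + 1 by rewrite ltr_wpDl.
have e2 : 0 < e / (`|M| + 1) by rewrite divr_gt0.
apply: filterS2 (vF _ e2) bG => t h1 h2; apply: le_trans (taxiM _ _) _.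
rewrite -(divfK (lt0r_neq0 M0) e) ler_pM ?taxi_ge0 //.
by apply: le_trans h2 (le_trans (ler_norm _) _); rewrite lerDl.
Qed.

Lemma bounded_cst a z : bounded_at (fun=> a) z.
Proof. by exists (taxi a); apply/near_pairP; exists 1. Qed.

Lemma boundedD F G z : bounded_at F z -> bounded_at G z ->
  bounded_at (fun t => F t + G t) z.
Proof.
move=> [M bF] [N bG]; exists (M + N); apply: filterS2 bF bG => t h1 h2.
by apply: le_trans (taxiD _ _) _; rewrite lerD.
Qed.

Lemma boundedM F G z : bounded_at F z -> bounded_at G z ->
  bounded_at (fun t => F t * G t) z.
Proof.
move=> [M bF] [N bG]; exists (M * N); apply: filterS2 bF bG => t h1 h2.
by apply: le_trans (taxiM _ _) _; rewrite ler_pM ?taxi_ge0.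
Qed.

Lemma vanishes_increment z : vanishes_at (fun t => cplx t - cplx z) z.
Proof.
move=> e e0; apply/near_pairP; exists (e / 2); first by rewrite divr_gt0.
case: z => x0 y0 x y h1 h2; rewrite /taxi /cplx complex_subE /=.
by rewrite [e]splitr lerD // ltW.
Qed.

Lemma taylor2_bounded F z c1 c2 : taylor2_at F z c1 c2 -> bounded_at F z.
Proof.
move=> [eta /vanishes_bounded veta E].
have [M bM] : bounded_at (fun t => F z + c1 * (cplx t - cplx z) +
    c2 * (cplx t - cplx z) ^+ 2 + eta t * (cplx t - cplx z) ^+ 2) z.
  have bd := vanishes_bounded (vanishes_increment z).
  have bc a := bounded_cst a z.
  by apply: boundedD; [apply: boundedD; [apply: boundedD|]|];
    try exact: bc; apply: boundedM; try exact: bc; try exact: boundedM.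
by exists M; apply: filterS2 E bM => t ->.
Qed.

Lemma taylor2M F G z a1 a2 b1 b2 :
  taylor2_at F z a1 a2 -> taylor2_at G z b1 b2 ->
  taylor2_at (fun t => F t * G t) z (F z * b1 + a1 * G z)
    (F z * b2 + a1 * b1 + a2 * G z).
Proof.
move=> TF TG; have bG := taylor2_bounded TG.
case: TF TG => [eF vF EF] [eG vG EG].
pose d t := cplx t - cplx z.
have vd : vanishes_at d z by exact: vanishes_increment.
have bd := vanishes_bounded vd; have bc a := bounded_cst a z.
exists (fun t => eF t * G t + eG t * (F z + a1 * d t + a2 * (d t * d t)) +
  d t * (a1 * b2 + a2 * b1 + a2 * b2 * d t)).
  apply: vanishesD; first apply: vanishesD; apply: vanishesM => //.
    apply: boundedD; last by apply: boundedM => //; exact: boundedM.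
    by apply: boundedD => //; exact: boundedM.
  by apply: boundedD => //; exact: boundedM.
apply: filterS2 EF EG => t hF hG; rewrite -!/(d t) in hF hG *.
transitivity ((F z + a1 * d t + a2 * d t ^+ 2) * G t + eF t * G t * d t ^+ 2).
  by rewrite hF; ring.
by rewrite {1}hG; ring.
Qed.

End ComplexTaylor.

(** * A maximum principle for functions with second order expansions *)

Section MaximumPrinciple.
Variable R : realType.
Local Notation C := (complex R).
Implicit Types (z : R * R) (a b c w : C).

(** The geometric expansion 1 / (w + d) = 1/w - d/w^2 + d^2/w^3 - d^3 / (w^3 (w + d)), with w = z -
    p, whose last denominator stays away from 0 near [z]. *)
Lemma taylor2V z (p : C) : cplx z != p ->
  exists c1 c2, taylor2_at (fun t => (cplx t - p)^-1) z c1 c2.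
Proof.
rewrite -subr_eq0; set w := cplx z - p => w0.
pose d t := cplx t - cplx z; pose m t := (cplx t - p)^-1.
have tw0 : 0 < taxi w.
  by rewrite lt_neqAle taxi_ge0 andbT eq_sym; apply: contra w0 => /eqP/taxi_eq0->.
have near_w : \forall t \near z, taxi (d t) <= taxi w / 2.
  by apply: vanishes_increment; rewrite divr_gt0.
have wE t : cplx t - p = w + d t by rewrite /w /d; ring.
have far t : taxi (d t) <= taxi w / 2 -> taxi w / 2 <= taxi (w + d t).
  move=> h; have := taxiD (w + d t) (- d t); rewrite addrK taxiN; lra.
have bm : bounded_at m z.
  exists (4 / taxi w); apply: filterS near_w => t /far h.
  have := taxiV (w + d t); rewrite /m wE ler_pdivlMr // => h1.
  have := ler_wpM2l (taxi_ge0 (w + d t)^-1) h; lra.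
exists (- w^-1 ^+ 2), (w^-1 ^+ 3), (fun t => d t * (- w^-1 ^+ 3 * m t)).
  apply: vanishesM; first exact: vanishes_increment.
  by apply: boundedM => //; exact: bounded_cst.
apply: filterS near_w => t /far h; rewrite -/(d t) /m wE -/w.
have wd0 : w + d t != 0.
  apply/eqP => E; move: h; rewrite E taxi0; lra.
by field; rewrite wd0 w0.
Qed.

Lemma taylor2_exprM F z (p : C) n : cplx z != p ->
  (exists c1 c2, taylor2_at F z c1 c2) ->
  exists c1 c2, taylor2_at (fun t => F t * (cplx t - p)^-1 ^+ n) z c1 c2.
Proof.
move=> /taylor2V[m1 [m2 mP]] FP; elim: n => [|n [c1 [c2 IH]]].
  case: FP => c1 [c2 FP]; exists c1, c2.
  by under eq_fun do rewrite expr0 mulr1.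
do 2 eexists; under eq_fun do rewrite exprSr mulrA.
exact: taylor2M IH mP.
Qed.

(** Parseval over the fourth roots of unity, on which 1, d and d^2 are pairwise orthogonal
    characters; hence no cross terms. *)
Lemma sqmod_four_points (c0 c1 c2 : C) (t : R) :
  let T d := c0 + c1 * d + c2 * d ^+ 2 in
  sqmod (T (Complex t 0)) + sqmod (T (Complex (- t) 0)) +
  sqmod (T (Complex 0 t)) + sqmod (T (Complex 0 (- t))) =
  4 * sqmod c0 + 4 * t ^+ 2 * sqmod c1 + 4 * t ^+ 4 * sqmod c2.
Proof.
case: c0 c1 c2 => [a0 b0] [a1 b1] [a2 b2] /=.
by rewrite !complex_expr2E !complex_mulE !complex_addE /sqmod /=; ring.
Qed.

(* Averaging [sqmod F] over the four points at distance t along the axes cancels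
   all cross terms up to o(t^2), so the strictly convex term wins. *)
Lemma taylor2_no_local_max F z c1 c2 (e : R) : taylor2_at F z c1 c2 -> 0 < e ->
  ~ \forall t \near z,
      sqmod (F t) + e * (t.1 ^+ 2 + t.2 ^+ 2) <=
      sqmod (F z) + e * (z.1 ^+ 2 + z.2 ^+ 2).
Proof.
move=> [eta veta EF] e0 zmax.
pose B := taxi (F z) + taxi c1 + taxi c2.
have B0 : 0 <= B by rewrite !addr_ge0 ?taxi_ge0.
(* With this bound on [eta], the remainder lowers [sqmod] by at most e B / (B + 1) t^2 at each of
   the four points. That is strictly less than e t^2, the average gain of the term in [e]. *)
have k0 : 0 < e / (2 * (B + 1)) by rewrite divr_gt0 // mulr_gt0 //; lra.
have /near_pairP[r r0 H] : \forall t \near z, [/\ taxi (eta t) <= e / (2 * (B + 1)),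
    F t = F z + c1 * (cplx t - cplx z) + c2 * (cplx t - cplx z) ^+ 2
          + eta t * (cplx t - cplx z) ^+ 2 &
    sqmod (F t) + e * (t.1 ^+ 2 + t.2 ^+ 2) <=
      sqmod (F z) + e * (z.1 ^+ 2 + z.2 ^+ 2)].
  by apply: filterS3 (veta _ k0) EF zmax => t h1 h2 h3.
set x := z.1 in H *; set y := z.2 in H *.
pose t := Num.min (r / 2) 1.
have t0 : 0 < t by rewrite lt_min ltr01 andbT divr_gt0.
have t1 : t <= 1 by rewrite ge_min lexx orbT.
have tr : t < r by rewrite gt_min; apply/orP; left; lra.
have step (s1 s2 : R) : `|s1| + `|s2| = t ->
    sqmod (F z + c1 * Complex s1 s2 + c2 * Complex s1 s2 ^+ 2)
      - e * B / (B + 1) * t ^+ 2 + e * ((x + s1) ^+ 2 + (y + s2) ^+ 2)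
    <= sqmod (F z) + e * (x ^+ 2 + y ^+ 2).
  move=> s12; have s1r : `|s1| < r.
    by apply: le_lt_trans tr; rewrite -s12 lerDl.
  have s2r : `|s2| < r by apply: le_lt_trans tr; rewrite -s12 lerDr.
  have := H (x + s1) (y + s2); rewrite !(addrC _ s1) !(addrC _ s2) !addrK.
  move=> /(_ s1r s2r)[h1 h2]; apply: le_trans; rewrite /= lerD2r {}h2.
  have -> : cplx (s1 + x, s2 + y) - cplx z = Complex s1 s2.
    by rewrite /cplx complex_subE /= !addrK.
  set d := Complex s1 s2; set T := F z + c1 * d + c2 * d ^+ 2.
  apply: le_trans (sqmod_perturb _ _); rewrite lerD2l lerN2.
  have td : taxi d = t by [].
  have td2 : taxi (d ^+ 2) <= t ^+ 2 by rewrite expr2 -td; exact: taxiM.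
  have tT : taxi T <= B.
    have t21 : t ^+ 2 <= 1 by rewrite expr_le1 // ltW.
    apply: le_trans (taxiD _ _) _; apply: lerD; last first.
      apply: le_trans (taxiM _ _) _; rewrite ler_piMr ?taxi_ge0 //.
      exact: le_trans td2 t21.
    apply: le_trans (taxiD _ _) _; rewrite lerD2l.
    by apply: le_trans (taxiM _ _) _; rewrite td ler_piMr ?taxi_ge0.
  have te : taxi (eta (s1 + x, s2 + y) * d ^+ 2) <= e / (2 * (B + 1)) * t ^+ 2.
    by apply: le_trans (taxiM _ _) _; rewrite ler_pM ?taxi_ge0.
  have -> : e * B / (B + 1) * t ^+ 2 = 2 * (B * (e / (2 * (B + 1)) * t ^+ 2)).
    by field; rewrite gt_eqF //; lra.
  by rewrite ler_pM2l // ler_pM ?taxi_ge0.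
have := sqmod_four_points (F z) c1 c2 t.
have := step t 0; have := step (- t) 0; have := step 0 t; have := step 0 (- t).
rewrite !normrN !normr0 !addr0 !add0r !(ger0_norm (ltW t0)).
move=> /(_ erefl) h1 /(_ erefl) h2 /(_ erefl) h3 /(_ erefl) h4 /= E.
have p1 : 0 <= t ^+ 2 * sqmod c1 by rewrite mulr_ge0 ?sqr_ge0 ?sqmod_ge0.
have p2 : 0 <= t ^+ 4 * sqmod c2 by rewrite mulr_ge0 ?exprn_even_ge0 ?sqmod_ge0.
have p3 : e * B / (B + 1) * t ^+ 2 < e * t ^+ 2.
  rewrite ltr_pM2r ?exprn_gt0 // -mulrA gtr_pMr // ltr_pdivrMr; lra.
move: h1 h2 h3 h4 E p1 p2 p3; clear; lra.
Qed.

Lemma taylor2_sqmod_continuous F z c1 c2 : taylor2_at F z c1 c2 ->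
  {for z, continuous (fun t => sqmod (F t))}.
Proof.
move=> [eta veta EF]; pose d t := cplx t - cplx z.
have vd : vanishes_at (fun t => F t - F z) z.
  have vd : vanishes_at d z by exact: vanishes_increment.
  have bd := vanishes_bounded vd; have bc a := bounded_cst a z.
  have be := vanishes_bounded veta.
  have vM : vanishes_at (fun t => d t * (c1 + c2 * d t + eta t * d t)) z.
    apply: vanishesM => //; apply: boundedD; last exact: boundedM.
    by apply: boundedD => //; exact: boundedM.
  move=> e e0; apply: filterS2 EF (vM _ e0) => t -> h.
  by rewrite (_ : _ - F z = d t * (c1 + c2 * d t + eta t * d t)) // /d; ring.
have cRe : (fun t => complex.Re (F t)) @ z --> complex.Re (F z).
  apply/cvgrPdist_le => e e0; apply: filterS (vd _ e0) => t; apply: le_trans.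
  by rewrite distrC; case: (F t) (F z) => [a b] [a' b']; rewrite lerDl.
have cIm : (fun t => complex.Im (F t)) @ z --> complex.Im (F z).
  apply/cvgrPdist_le => e e0; apply: filterS (vd _ e0) => t; apply: le_trans.
  by rewrite distrC; case: (F t) (F z) => [a b] [a' b']; rewrite lerDr.
by apply: cvgD; apply: cvgM.
Qed.

End MaximumPrinciple.

(** * Vanishing on a circular cap of a function that vanishes on its chord *)

Section BoundaryVanishing.
Variable R : realType.
Local Notation C := (complex R).
Implicit Types z : R * R.

Lemma sqmodV (w : C) : sqmod w^-1 = (sqmod w)^-1.
Proof.
have [->|w0] := eqVneq w 0; first by rewrite invr0 /sqmod /= expr0n addr0 invr0.
have sw0 : sqmod w != 0 by apply: contra w0 => /eqP/sqmod_eq0->.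
apply: (mulIf sw0); rewrite -sqmodM !mulVf //.
by rewrite /sqmod /= expr0n addr0 expr1n.
Qed.

Lemma sqmodX (w : C) n : sqmod (w ^+ n) = sqmod w ^+ n.
Proof.
elim: n => [|n IH]; last by rewrite !exprS sqmodM IH.
by rewrite !expr0 /sqmod /= expr0n addr0 expr1n.
Qed.

Lemma coordinates_continuous (c : R) :
  continuous (fun z : R * R => z.1 ^+ 2 + (z.2 + c) ^+ 2).
Proof.
move=> z; have c1 : (fun t : R * R => t.1) @ z --> z.1 by exact: cvg_fst.
have c2 : (fun t : R * R => t.2 + c) @ z --> z.2 + c.
  by apply: cvgD; [exact: cvg_snd|exact: cvg_cst].
by apply: cvgD; apply: cvgM.
Qed.

(** [A] is the square of the radius of the disc centered at -i c. *)
Definition cap (c A : R) : set (R * R) :=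
  [set z | 0 <= z.2 /\ z.1 ^+ 2 + (z.2 + c) ^+ 2 <= A].

Lemma cap_compact (c A : R) : 0 < c -> compact (cap c A).
Proof.
move=> c0; set B := `|A| + 1.
have cB : compact (`[- B, B]%classic `*` `[- B, B]%classic).
  by apply: compact_setX; exact: segment_compact.
apply: (subclosed_compact _ cB).
  apply: closedI.
    have /continuous_closedP/(_ _ (@closed_ge R 0)) : continuous (@snd R R).
      by move=> z; exact: cvg_snd.
    by [].
  have /continuous_closedP/(_ _ (@closed_le R A)) := @coordinates_continuous c.
  by [].
move=> [x y] [/= y0 xy]; have BA : A + 1 <= B by rewrite lerD2r ler_norm.
have B1 : 1 <= B by rewrite lerDr.
have segm t : t ^+ 2 <= A -> t \in `[- B, B].
  rewrite in_itv /= -ler_norml -(@real_normK _ t) ?num_real // => tA.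
  rewrite leNgt; apply/negP => Bt; have t0 := normr_ge0 t.
  by move: tA BA B1 Bt t0; clear; move: B `|t| => b u; nra.
by split; apply: segm => /=; nra.
Qed.

(* The maximum principle for [F z / (z + i c)^n], whose square modulus on the arc
   [|z + i c|^2 = A] is at most [M / A^n]; the term in [e] makes the function
   strictly subharmonic. *)
Lemma cap_maximum (F : R * R -> C) (c A M e : R) n z : 0 < c -> 0 < e ->
  (forall z, cap c A z -> exists c1 c2, taylor2_at F z c1 c2) ->
  (forall z, cap c A z -> z.2 = 0 -> F z = 0) ->
  (forall z, cap c A z -> sqmod (F z) <= M) -> cap c A z ->
  sqmod (F z) / (z.1 ^+ 2 + (z.2 + c) ^+ 2) ^+ n <= M / A ^+ n + e * A.
Proof.
move=> c0 e0 TF F0 FM Kz.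
pose den (t : R * R) := t.1 ^+ 2 + (t.2 + c) ^+ 2.
pose p : C := Complex 0 (- c).
pose G t := F t * (cplx t - p)^-1 ^+ n.
pose W t := sqmod (G t) + e * (t.1 ^+ 2 + t.2 ^+ 2).
have denp t : cap c A t -> cplx t != p /\ 0 < den t.
  move: t => [x y] [/= y0 _]; split.
    by rewrite eq_complex /= negb_and orbC gt_eqF //; lra.
  by rewrite ltr_wpDl ?sqr_ge0 // exprn_gt0 //= ltr_wpDl.
have GE t : sqmod (G t) = sqmod (F t) / den t ^+ n.
  rewrite /G sqmodM sqmodX sqmodV exprVn; congr (_ / _ ^+ n).
  by case: t => x y; rewrite /p /cplx complex_subE /sqmod /den /= subr0 opprK.
have TG t : cap c A t -> exists c1 c2, taylor2_at G t c1 c2.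
  by move=> Kt; apply: taylor2_exprM; [case: (denp _ Kt)|exact: TF].
have sq_le t : cap c A t -> t.1 ^+ 2 + t.2 ^+ 2 <= A.
  by move: t => [x y] [/= y0]; nra.
have A0 : 0 < A by case: (denp _ Kz) => _ /lt_le_trans; apply; case: Kz.
have M0 : 0 <= M by exact: le_trans (sqmod_ge0 _) (FM _ Kz).
have cW : {within cap c A, continuous W}.
  apply: continuous_in_subspaceT => t /set_mem/TG[c1 [c2 Tt]].
  apply: cvgD; first exact: taylor2_sqmod_continuous Tt.
  apply: cvgM; first exact: cvg_cst.
  have := @coordinates_continuous 0 t; rewrite /continuous_at /=.
  by under eq_fun do rewrite addr0; rewrite addr0.
have [|t /set_mem Kt tmax] := compact_EVT_max _ (cap_compact (A := A) c0) cW.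
  by exists z.
suff Wt : W t <= M / A ^+ n + e * A.
  apply: le_trans Wt; apply: le_trans (tmax z (mem_set Kz)).
  by rewrite /W GE lerDl mulr_ge0 ?addr_ge0 ?sqr_ge0 // ltW.
have et : e * (t.1 ^+ 2 + t.2 ^+ 2) <= e * A by rewrite ler_pM2l // sq_le.
(* The maximum point [t] of [W] lies on the chord, where [F] is zero, or on the arc, where the
   denominator is A^n, or in the interior, where [taylor2_no_local_max] excludes it. *)
have [t20|t20] := eqVneq t.2 0.
  rewrite /W /G F0 // mul0r /sqmod /= expr0n addr0 add0r.
  by apply: ler_wpDl => //; rewrite divr_ge0 // exprn_ge0 // ltW.
have [dt|dt] := eqVneq (den t) A.
  by rewrite /W GE dt lerD // ler_pM2r ?FM // invr_gt0 exprn_gt0.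
have t2 : 0 < t.2 by rewrite lt_neqAle eq_sym t20; case: Kt.
have dtA : den t < A by rewrite lt_neqAle dt; case: Kt.
have [c1 [c2 Tt]] := TG _ Kt; exfalso; apply: (taylor2_no_local_max Tt e0).
have n2 : \forall s \near t, 0 < s.2.
  by apply: (@cvgr_gt _ _ (nbhs t) _ snd t.2) => //; exact: cvg_snd.
have nd : \forall s \near t, den s < A.
  apply: (@cvgr_lt _ _ (nbhs t) _ den (den t)) => //.
  exact: coordinates_continuous.
apply: filterS2 n2 nd => s s2 ds; apply: tmax; apply: mem_set.
by split; exact: ltW.
Qed.

(** With [M] the maximum of [sqmod F] on the cap, letting e tend to 0 in [cap_maximum] bounds
    [sqmod (F z)] by M (d / A)^n for every n, and d / A < 1 because [z] is strictly inside the
    arc. *)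
Lemma cap_vanishing (F : R * R -> C) (c A : R) z : 0 < c ->
  (forall z, cap c A z -> exists c1 c2, taylor2_at F z c1 c2) ->
  (forall z, cap c A z -> z.2 = 0 -> F z = 0) ->
  0 <= z.2 -> z.1 ^+ 2 + (z.2 + c) ^+ 2 < A -> F z = 0.
Proof.
move=> c0 TF F0 z0 zA; have Kz : cap c A z by split => //; exact: ltW.
have cF : {within cap c A, continuous (fun t => sqmod (F t))}.
  apply: continuous_in_subspaceT => t /set_mem/TF[c1 [c2 Tt]].
  exact: taylor2_sqmod_continuous Tt.
have [|t0 _ tmax] := compact_EVT_max _ (cap_compact (A := A) c0) cF; first by exists z.
set M := sqmod (F t0) in tmax.
have FM t : cap c A t -> sqmod (F t) <= M by move=> /mem_set; exact: tmax.
set d := z.1 ^+ 2 + (z.2 + c) ^+ 2 in zA.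
have d0 : 0 < d by rewrite ltr_wpDl ?sqr_ge0 // exprn_gt0 // ltr_wpDl.
have A0 : 0 < A by exact: lt_trans zA.
have bound n : sqmod (F z) <= M * (d / A) ^+ n.
  have : sqmod (F z) / d ^+ n <= M / A ^+ n.
    apply/ler_addgt0Pr => e e0.
    rewrite -[e](divfK (lt0r_neq0 A0)); apply: cap_maximum => //.
    by rewrite divr_gt0.
  by rewrite ler_pdivrMr ?exprn_gt0 // expr_div_n mulrAC mulrA.
apply: sqmod_eq0; apply/eqP; rewrite eq_le sqmod_ge0 andbT.
have k1 : `|d / A| < 1.
  by rewrite ger0_norm ?divr_ge0 ?(ltW d0) ?(ltW A0) // ltr_pdivrMr // mul1r.
have lim0 : (fun n => M * (d / A) ^+ n) @ \oo --> M * 0.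
  by apply: cvgM; [exact: cvg_cst|exact: cvg_expr].
rewrite mulr0 in lim0; apply: (cvgr_to_ge lim0).
exact: nearW.
Qed.

End BoundaryVanishing.

(** * Unique continuation from the real axis for Cauchy-Riemann pairs *)

Section Uniqueness.
Variable R : realType.
Local Notation C := (complex R).
Implicit Types (z : R * R) (u v : R -> R -> R).

Definition cauchy_riemann_at u v (x y : R) := exists a b : R,
  has_gradient u x y a (- b) /\ has_gradient v x y b a.

Lemma has_gradientN u (x y a b : R) :
  has_gradient u x y a b -> has_gradient (fun x y => - u x y) x y (- a) (- b).
Proof.
move=> H e e0; have [r r0 {}H] := H e e0; exists r => // x' y' h1 h2.
apply: le_trans (H _ _ h1 h2); rewrite -normrN le_eqVlt; apply/orP; left.
by apply/eqP; congr Num.norm; ring.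
Qed.

(** The two components integrate the real and imaginary parts of (u + i v)(dx + i dy), namely u dx -
    v dy and v dx + u dy; the Cauchy-Riemann equations say that both forms are closed. *)
Definition complex_primitive u v z : C :=
  Complex (potential u (fun x y => - v x y) z.1 z.2) (potential v u z.1 z.2).

Lemma complex_primitive_taylor u v (rho : R) z :
  (forall y, continuous (u^~ y)) -> (forall x, continuous (u x)) ->
  (forall y, continuous (v^~ y)) -> (forall x, continuous (v x)) ->
  0 < rho -> rho <= 1 ->
  (forall x y, x ^+ 2 + y ^+ 2 < rho ^+ 2 -> cauchy_riemann_at u v x y) ->
  (forall x, x ^+ 2 < rho ^+ 2 -> u x 0 = 0 /\ v x 0 = 0) ->
  z.1 ^+ 2 + z.2 ^+ 2 < rho ^+ 2 ->
  exists c2, taylor2_at (complex_primitive u v) z (Complex (u z.1 z.2) (v z.1 z.2)) c2.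
Proof.
move=> cux cuy cvx cvy rho0 rho1 cr uv0 zrho.
have [a [b [Du Dv]]] := cr _ _ zrho; have Dnv := has_gradientN Dv.
set F := complex_primitive u v; set c1 := Complex _ _; pose c2 := Complex (a / 2) (b / 2).
pose d t := cplx t - cplx z; pose T t := F z + c1 * d t + c2 * d t ^+ 2.
(* Taking [eta] as this quotient makes the expansion an identity, including at [z] itself, where F
   and T agree. What has to be proved is that the quotient tends to 0. *)
exists c2, (fun t => (F t - T t) / d t ^+ 2); last first.
  apply/near_pairP; exists 1 => // x y _ _; rewrite -/(d _) -/(T _).
  have [d0|d0] := eqVneq (d (x, y)) 0; last by field.
  suff -> : (x, y) = z by rewrite /T /d subrr expr0n !mulr0 !addr0.
  move/subr0_eq: d0; case: z {Du Dv Dnv zrho F c1 d T} => x' y' [-> ->].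
  by [].
(* Two components with error e / 8 add up to e / 4, and dividing by d^2 costs a factor 4, the square
   of the constant in [taxiV]. *)
move=> e e0; have e8 : 0 < e / 8 by rewrite divr_gt0.
have cnv x : continuous (fun y => - v x y) by move=> y; apply: cvgN; exact: cvy.
have clu x y : x ^+ 2 + y ^+ 2 < rho ^+ 2 -> closed_form_at u (fun x y => - v x y) x y.
  by move=> /cr[a' [b' [h1 h2]]]; exists a', (- b'), (- a'); split => //;
    exact: has_gradientN.
have clv x y : x ^+ 2 + y ^+ 2 < rho ^+ 2 -> closed_form_at v u x y.
  by move=> /cr[a' [b' [h1 h2]]]; exists b', a', (- b').
have u0 x : x ^+ 2 < rho ^+ 2 -> u x 0 = 0 by move=> /uv0[].
have v0 x : x ^+ 2 < rho ^+ 2 -> v x 0 = 0 by move=> /uv0[].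
have [r1 r10 H1] := potential_taylor cux cnv rho0 rho1 clu u0 zrho Du Dnv e8.
have [r2 r20 H2] := potential_taylor cvx cuy rho0 rho1 clv v0 zrho Dv Du e8.
apply/near_pairP; exists (Num.min r1 r2); first by rewrite lt_min r10.
move=> x y; rewrite !lt_min => /andP[s1 s2] /andP[t1 t2].
have {H1 s1 t1} H1 := H1 _ _ s1 t1; have {H2 s2 t2} H2 := H2 _ _ s2 t2.
have dE : d (x, y) = Complex (x - z.1) (y - z.2) by [].
have FT : taxi (F (x, y) - T (x, y)) <= e / 4 * taxi (d (x, y)) ^+ 2.
  rewrite [leRHS](_ : _ = e / 8 * taxi (d (x, y)) ^+ 2 + e / 8 * taxi (d (x, y)) ^+ 2);
    last by field.
  rewrite /T dE /F /complex_primitive /c1 /c2 complex_expr2E.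
  rewrite !complex_mulE !complex_addE /taxi /=.
  apply: lerD.
    apply: le_trans H1; rewrite le_eqVlt; apply/orP; left; apply/eqP.
    by congr Num.norm; rewrite /=; field.
  apply: le_trans H2; rewrite le_eqVlt; apply/orP; left; apply/eqP.
  by congr Num.norm; rewrite /=; field.
apply: le_trans (taxiM _ _) _; rewrite -exprVn.
have tV : taxi ((d (x, y))^-1 ^+ 2) <= taxi (d (x, y))^-1 ^+ 2.
  by rewrite !expr2; exact: taxiM.
apply: le_trans (ler_pM (taxi_ge0 _) (taxi_ge0 _) FT tV) _.
have := taxiV (d (x, y)); have := taxi_ge0 (d (x, y)); have := taxi_ge0 (d (x, y))^-1.
move: (taxi (d _)^-1) (taxi (d _)) => p q p0 q0 pq.
have pq2 : (p * q) ^+ 2 <= 4.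
  have := mulr_ge0 p0 q0; move: (p * q) pq => w w2 w0; nra.
rewrite [leLHS](_ : _ = e / 4 * (p * q) ^+ 2); last by ring.
by rewrite -[leRHS](divfK (_ : 4 != 0)) // ler_pM2l // divr_gt0.
Qed.

(** This recovers u + i v from its primitive: dividing the expansion of 0 by a nonzero increment d
    leaves c1 = - d (c2 + eta), which is arbitrarily small. *)
Lemma taylor2_zero (F : R * R -> C) z (c1 c2 : C) : taylor2_at F z c1 c2 ->
  (\forall t \near z, F t = 0) -> c1 = 0.
Proof.
move=> [eta veta EF] nF; apply: taxi_eq0; apply/eqP; rewrite eq_le taxi_ge0 andbT.
have Fz : F z = 0 by exact: nbhs_singleton nF.
pose d t := cplx t - cplx z.
have vd : vanishes_at (fun t => d t * (c2 + eta t)) z.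
  apply: vanishesM; first exact: vanishes_increment.
  by apply: boundedD; [exact: bounded_cst|exact: vanishes_bounded].
apply/ler_addgt0Pr => e e0; rewrite add0r.
have /near_pairP[r r0 H] : \forall t \near z, c1 * d t + c2 * d t ^+ 2 + eta t * d t ^+ 2 = 0
    /\ taxi (d t * (c2 + eta t)) <= e.
  apply: filterS3 EF nF (vd _ e0) => t; rewrite Fz add0r => <- -> h.
  by split.
have [] := H (z.1 + r / 2) z.2.
- by rewrite addrAC subrr add0r gtr0_norm ?divr_gt0 //; lra.
- by rewrite subrr normr0.
set t := (_, _) => E; have d0 : d t != 0.
  rewrite /d /cplx complex_subE eq_complex /= negb_and; apply/orP; left.
  by rewrite addrAC subrr add0r gt_eqF // divr_gt0.
rewrite (_ : d t * (c2 + eta t) = - c1) ?taxiN //.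
apply: (mulIf d0); apply/eqP; rewrite -subr_eq0 -E; apply/eqP; ring.
Qed.

Theorem cauchy_riemann_vanishing u v (rho : R) :
  (forall y, continuous (u^~ y)) -> (forall x, continuous (u x)) ->
  (forall y, continuous (v^~ y)) -> (forall x, continuous (v x)) ->
  0 < rho -> rho <= 1 ->
  (forall x y, x ^+ 2 + y ^+ 2 < rho ^+ 2 -> cauchy_riemann_at u v x y) ->
  (forall x, x ^+ 2 < rho ^+ 2 -> u x 0 = 0 /\ v x 0 = 0) ->
  forall x y, 0 < y -> x ^+ 2 + y ^+ 2 < rho ^+ 2 -> u x y = 0.
Proof.
move=> cux cuy cvx cvy rho0 rho1 cr uv0.
have FT z : z.1 ^+ 2 + z.2 ^+ 2 < rho ^+ 2 -> exists c2,
    taylor2_at (complex_primitive u v) z (Complex (u z.1 z.2) (v z.1 z.2)) c2.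
  exact: complex_primitive_taylor.
have F0 z : 0 < z.2 -> z.1 ^+ 2 + z.2 ^+ 2 < rho ^+ 2 -> complex_primitive u v z = 0.
  move=> z0 zr; pose k := rho ^+ 2 - (z.1 ^+ 2 + z.2 ^+ 2).
  have k0 : 0 < k by rewrite subr_gt0.
  have rr1 : rho ^+ 2 <= 1 by rewrite expr_le1 // ltW.
  (* With c = k / 8, the cap is given by |t|^2 + (k / 4) t.2 <= rho^2 - k / 2 in the upper half
     plane, so it lies in the disc. It contains [z] strictly inside the arc, because |z|^2 = rho^2 -
     k and z.2 <= 1. *)
  apply: (@cap_vanishing _ _ (k / 8) ((k / 8) ^+ 2 + (rho ^+ 2 - k / 2))).
  - by rewrite divr_gt0.
  - move=> [x y] [/= y0 xy].
    have /FT[c2 Tt] : (x, y).1 ^+ 2 + (x, y).2 ^+ 2 < rho ^+ 2.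
      have := mulr_ge0 y0 (ltW k0); move: xy k0 => /=; clear.
      move: k => k xy k0 yk; nra.
    by exists (Complex (u x y) (v x y)), c2.
  - by move=> [x y] _ /= ->; rewrite /complex_primitive /potential /= !subrr.
  - exact: ltW.
  - have z1 : z.2 <= 1 by move: zr rr1 z0; clear; nra.
    by rewrite /k in k0 *; move: z0 z1 k0; clear; nra.
move=> x y y0 xy; have [c2 Tt] := FT (x, y) xy.
suff /eqP : Complex (u x y) (v x y) = 0 by rewrite eq_complex => /andP[/eqP].
apply: (taylor2_zero Tt).
have n2 : \forall s \near (x, y), 0 < s.2.
  by apply: (@cvgr_gt _ _ (nbhs (x, y)) _ snd y) => //; exact: cvg_snd.
have nd : \forall s \near (x, y), s.1 ^+ 2 + (s.2 + 0) ^+ 2 < rho ^+ 2.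
  apply: (@cvgr_lt _ _ (nbhs (x, y)) _ _ _ (@coordinates_continuous R 0 (x, y))).
  by rewrite /= addr0.
by apply: filterS2 n2 nd => s s2; rewrite addr0; exact: F0.
Qed.

End Uniqueness.

(** * The representation formula for slice regular functions *)

Section SliceRepresentation.
Variable R : realType.
Local Notation H := (quaternion R).
Implicit Types (i j e p q : H) (f : H -> H) (x y : R).

Lemma qnormE q : `|q| = Num.sqrt (qdot q q). Proof. by []. Qed.

Lemma qdotC p q : qdot p q = qdot q p.
Proof. by rewrite /qdot; ring. Qed.

Lemma qdotDl p p' q : qdot (p + p') q = qdot p q + qdot p' q.
Proof. by rewrite /qdot /=; ring. Qed.

Lemma qdotZl (s : R) p q : qdot (s *: p) q = s * qdot p q.
Proof. by rewrite /qdot /=; ring. Qed.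

Lemma qdotNl p q : qdot (- p) q = - qdot p q.
Proof. by rewrite -scaleN1r qdotZl mulN1r. Qed.

Lemma qdotDr p q q' : qdot p (q + q') = qdot p q + qdot p q'.
Proof. by rewrite qdotC qdotDl !(qdotC _ p). Qed.

Lemma qdotZr (s : R) p q : qdot p (s *: q) = s * qdot p q.
Proof. by rewrite qdotC qdotZl qdotC. Qed.

Lemma qdotNr p q : qdot p (- q) = - qdot p q.
Proof. by rewrite qdotC qdotNl qdotC. Qed.

Lemma qdot_self q : qdot q q = `|q| ^+ 2.
Proof. by rewrite qnormE sqr_sqrtr ?qdot_ge0. Qed.

Lemma qdot_norm_le p q : `|qdot p q| <= `|p| * `|q|.
Proof.
have CS r : qdot r q <= `|r| * `|q| by exact: qdot_CauchySchwarz.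
by rewrite ler_norml CS andbT lerNl -qdotNl -(normrN p) CS.
Qed.

Lemma S2_qdot i : S2 i -> qdot i i = 1.
Proof. by move=> [_ i1]; rewrite qdot_self i1 expr1n. Qed.

Lemma S2_opp i : S2 i -> S2 (- i).
Proof. by move=> [i0 i1]; split; rewrite ?normrN //= i0 oppr0. Qed.

(** With the next two lemmas, this makes left multiplication by [i] a complex structure compatible
    with [qdot]. *)
Lemma S2_adjoint i p q : S2 i -> qdot (i * p) q = - qdot p (i * q).
Proof.
move=> [+ _]; case: i p q => [a b c d] [x y z w] [x' y' z' w'] /= ->.
by rewrite /qdot /=; ring.
Qed.

Lemma S2_isometry i p q : S2 i -> qdot (i * p) (i * q) = qdot p q.
Proof.
move=> Si; rewrite -[RHS]mul1r -(S2_qdot Si); case: Si => + _.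
case: i p q => [a b c d] [x y z w] [x' y' z' w'] /= ->.
by rewrite /qdot /=; ring.
Qed.

Lemma S2_sqr i q : S2 i -> i * (i * q) = - q.
Proof.
move=> Si; rewrite -[q in RHS]scale1r -(S2_qdot Si); case: Si => + _.
case: i q => [a b c d] [x y z w] /= ->.
by congr Quaternion; rewrite /qdot /=; ring.
Qed.

Lemma slice_point_norm i x y : S2 i -> `|x%:A + y *: i| ^+ 2 = x ^+ 2 + y ^+ 2.
Proof.
move=> Si; rewrite -qdot_self -[y ^+ 2]mulr1 -(S2_qdot Si); case: Si => + _.
by case: i => [a b c d] /= ->; rewrite /qdot /=; ring.
Qed.

Lemma D4_slice_point i x y : S2 i -> D4 (x%:A + y *: i) <-> x ^+ 2 + y ^+ 2 < 1.
Proof.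
move=> Si; rewrite -(slice_point_norm x y Si) /D4 /=.
by rewrite expr_lt1 //; split.
Qed.

Lemma slice_derivatives f i x y : differentiable f (x%:A + y *: i) ->
  derive1 (fun s : R => f (s%:A + y *: i)) x = 'd f (x%:A + y *: i) 1 /\
  derive1 (fun t : R => f (x%:A + t *: i)) y = 'd f (x%:A + y *: i) i.
Proof.
move=> df; rewrite !derive1E -!deriveE //; split; rewrite /derive;
  apply: (congr1 (fun g : R -> H => lim (g @ 0^')));
  apply/funext => h /=; congr (_ *: (f _ - _));
  have E (c : R) : h *: (1 : R) + c = h + c by rewrite /GRing.scale /= mulr1.
  by rewrite E scalerDl addrA.
by rewrite E scalerDl addrCA.
Qed.

Lemma slice_regular_cr f i x y : slice_regular f -> S2 i -> D4 (x%:A + y *: i) ->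
  'd f (x%:A + y *: i) 1 = - (i * 'd f (x%:A + y *: i) i).
Proof.
move=> [df rf] Si Dq; have [d1 d2] := slice_derivatives (df _ Dq).
have /eqP := rf i Si x y Dq; rewrite d1 d2 scaler_eq0 invr_eq0 pnatr_eq0 /=.
by rewrite addr_eq0 => /eqP.
Qed.

Lemma pairing_gradient f i e x y : S2 i -> differentiable f (x%:A + y *: i) ->
  has_gradient (fun x y => qdot (f (x%:A + y *: i)) e) x y
    (qdot ('d f (x%:A + y *: i) 1) e) (qdot ('d f (x%:A + y *: i) i) e).
Proof.
move=> Si; set q := x%:A + y *: i => /diff_locally /eqaddoP fq k k0.
have e0 : 0 < `|e| + 1 by rewrite ltr_wpDl.
have k1 : 0 < k / (`|e| + 1) by rewrite divr_gt0.
have /nbhs_ballP[r /= r0 {}fq] := fq _ k1.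
exists (r / 2); first by rewrite divr_gt0.
move=> x' y' hx hy.
have one1 : `|1 : H| = 1.
  by rewrite qnormE /qdot /= !mul0r !addr0 mulr1 sqrtr1.
pose h : H := (x' - x) *: 1 + (y' - y) *: i.
have hh : `|h| <= `|x' - x| + `|y' - y|.
  by apply: le_trans (ler_normD _ _) _; rewrite !normrZ one1 (proj2 Si) !mulr1.
have hr : ball (0 : H) r h.
  rewrite -ball_normE /= sub0r normrN; apply: le_lt_trans hh _; lra.
have := fq _ hr; rewrite !fctE /= /shift /=.
have -> : h + q = x'%:A + y' *: i.
  rewrite /h /q addrACA -!scalerDl !subrK //.
have -> : 'd f q h = (x' - x) *: 'd f q 1 + (y' - y) *: 'd f q i.
  by rewrite /h linearD !linearZ.
move=> H1.
have -> : qdot (f (x'%:A + y' *: i)) e -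
    (qdot (f q) e + qdot ('d f q 1) e * (x' - x) + qdot ('d f q i) e * (y' - y)) =
  qdot (f (x'%:A + y' *: i) - (f q + ((x' - x) *: 'd f q 1 + (y' - y) *: 'd f q i))) e.
  by rewrite qdotDl qdotNl !qdotDl !qdotZl; ring.
apply: le_trans (qdot_norm_le _ _) _.
apply: le_trans (ler_pM _ _ (le_trans H1 (ler_wpM2l (ltW k1) hh)) (lexx _)) _ => //.
rewrite mulrAC ler_wpM2r ?addr_ge0 // mulrAC ler_pdivrMr // ler_pM2l //; lra.
Qed.

Lemma has_gradient_local (u v : R -> R -> R) x y (a b r : R) : 0 < r ->
  (forall x' y', `|x' - x| < r -> `|y' - y| < r -> u x' y' = v x' y') ->
  has_gradient u x y a b -> has_gradient v x y a b.
Proof.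
move=> r0 uv Hu k k0; have [s s0 {}Hu] := Hu _ k0.
exists (Num.min r s); first by rewrite lt_min r0.
move=> x' y'; rewrite !lt_min => /andP[x1 x2] /andP[y1 y2].
by rewrite -!uv ?subrr ?normr0 //; apply: Hu.
Qed.

Lemma cauchy_riemannD (u v u' v' : R -> R -> R) x y :
  cauchy_riemann_at u v x y -> cauchy_riemann_at u' v' x y ->
  cauchy_riemann_at (fun x y => u x y + u' x y) (fun x y => v x y + v' x y) x y.
Proof.
have D w w' a b a' b' : has_gradient w x y a b -> has_gradient w' x y a' b' ->
    has_gradient (fun x y => w x y + w' x y) x y (a + a') (b + b').
  move=> Hw Hw' k k0; have k2 : 0 < k / 2 by rewrite divr_gt0.
  have [r r0 {}Hw] := Hw _ k2; have [r' r'0 {}Hw'] := Hw' _ k2.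
  exists (Num.min r r'); first by rewrite lt_min r0.
  move=> x' y'; rewrite !lt_min => /andP[x1 x2] /andP[y1 y2].
  have := lerD (Hw _ _ x1 y1) (Hw' _ _ x2 y2); rewrite -mulrDl -splitr.
  apply: le_trans; apply: le_trans (ler_normD _ _).
  by rewrite le_eqVlt; apply/orP; left; apply/eqP; congr Num.norm; ring.
move=> [a [b [Hu Hv]]] [a' [b' [Hu' Hv']]]; exists (a + a'), (b + b').
by rewrite opprD; split; apply: D.
Qed.

(* The radial retraction onto the closed ball of radius [rho] makes the real
   functions below continuous everywhere. *)
Definition retract (rho : R) q : H := (rho / Num.max rho `|q|) *: q.

Lemma retract_id (rho : R) q : 0 < rho -> `|q| <= rho -> retract rho q = q.
Proof. by move=> rho0 qr; rewrite /retract max_l // divff ?scale1r // gt_eqF. Qed.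

Lemma retract_norm (rho : R) q : 0 < rho -> `|retract rho q| <= rho.
Proof.
move=> rho0; rewrite normrZ; have m0 : 0 < Num.max rho `|q| by rewrite lt_max rho0.
rewrite ger0_norm ?divr_ge0 ?(ltW rho0) ?(ltW m0) //.
by rewrite mulrAC ler_pdivrMr // ler_pM2l // le_max lexx orbT.
Qed.

Lemma retract_continuous (rho : R) : 0 < rho -> continuous (retract rho).
Proof.
move=> rho0 q.
have cmax : (fun q : H => Num.max rho `|q|) @ q --> Num.max rho `|q|.
  apply: (@continuous_max R H (fun=> rho) (fun q => `|q|)); first exact: cst_continuous.
  exact: norm_continuous.
have cinv : (fun q : H => (Num.max rho `|q|)^-1) @ q --> (Num.max rho `|q|)^-1.
  by apply: cvgV cmax; rewrite gt_eqF // lt_max rho0.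
have cs : (fun q : H => rho / Num.max rho `|q|) @ q --> rho / Num.max rho `|q|.
  exact: cvgM (cvg_cst _) cinv.
exact: (continuousZ (f := id) cs cvg_id).
Qed.

Lemma qdot_continuous e : continuous (fun q => qdot q e).
Proof.
move=> q; apply/(@cvgrPdist_le _ _ _ (nbhs q) (nbhs_filter q)) => k k0.
have e0 : 0 < `|e| + 1 by rewrite ltr_wpDl.
apply/nbhs_ballP; exists (k / (`|e| + 1)) => /=; first by rewrite divr_gt0.
move=> p; rewrite -ball_normE /= => /ltW qp.
rewrite -qdotNl -qdotDl; apply: le_trans (qdot_norm_le _ _) _.
apply: le_trans (ler_pM _ _ qp (lexx _)) _ => //.
by rewrite mulrAC ler_pdivrMr // ler_pM2l //; lra.
Qed.

Definition pairing f (rho : R) i e x y : R :=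
  qdot (f (retract rho (x%:A + y *: i))) e.

Lemma pairing_continuous f (rho : R) i e : 0 < rho < 1 ->
  (forall q, D4 q -> differentiable f q) ->
  (forall y, continuous ((pairing f rho i e)^~ y)) /\
  (forall x, continuous (pairing f rho i e x)).
Proof.
move=> /andP[rho0 rho1] df.
have cF : continuous (fun q => qdot (f (retract rho q)) e).
  move=> q; apply: (@continuous_comp _ _ _ (f \o retract rho) (fun q => qdot q e)).
    apply: continuous_comp; first exact: retract_continuous.
    apply: differentiable_continuous; apply: df.
    exact: le_lt_trans (retract_norm _ rho0) rho1.
  exact: qdot_continuous.
split=> [y x|x y].
  apply: (@continuous_comp _ _ _ (fun x : R => x%:A + y *: i)
    (fun q => qdot (f (retract rho q)) e)); last exact: cF.
  have cx : (fun x : R => x%:A : H) @ x --> (x%:A : H) by exact: scalel_continuous.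
  exact: cvgD cx (cvg_cst _).
apply: (@continuous_comp _ _ _ (fun y : R => x%:A + y *: i)
    (fun q => qdot (f (retract rho q)) e)); last exact: cF.
have cy : (fun y : R => y *: i) @ y --> y *: i by exact: scalel_continuous.
exact: cvgD (cvg_cst _) cy.
Qed.

Lemma pairingE f (rho : R) i e x y : S2 i -> 0 < rho ->
  x ^+ 2 + y ^+ 2 <= rho ^+ 2 -> pairing f rho i e x y = qdot (f (x%:A + y *: i)) e.
Proof.
move=> Si rho0 xy; rewrite /pairing retract_id //.
by rewrite -(@ler_pXn2r _ 2) ?nnegrE ?(ltW rho0) // slice_point_norm.
Qed.

(** Slice regularity reads f_x = - i f_y. Moving [i] across the inner product gives <f_x, e> = <f_y,
    i e>, and the isometry gives <f_x, i e> = - <f_y, e>. *)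
Lemma pairing_cauchy_riemann f (rho : R) i e x y : slice_regular f -> S2 i ->
  0 < rho < 1 -> x ^+ 2 + y ^+ 2 < rho ^+ 2 ->
  cauchy_riemann_at (pairing f rho i e) (pairing f rho i (i * e)) x y.
Proof.
move=> rf Si /andP[rho0 rho1] xy.
have Dq : D4 (x%:A + y *: i).
  by apply/D4_slice_point => //; apply: lt_trans xy _; rewrite expr_lt1 // ltW.
have dq := (proj1 rf) _ Dq; have CR := slice_regular_cr rf Si Dq.
have /near_pairP[r r0 near_xy] : \forall t \near (x, y),
    t.1 ^+ 2 + (t.2 + 0) ^+ 2 < rho ^+ 2.
  apply: (@cvgr_lt _ _ (nbhs (x, y)) _ _ _ (@coordinates_continuous R 0 (x, y))).
  by rewrite /= addr0.
have grad e' : has_gradient (pairing f rho i e') x y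
    (qdot ('d f (x%:A + y *: i) 1) e') (qdot ('d f (x%:A + y *: i) i) e').
  apply: (has_gradient_local r0); last exact: pairing_gradient.
  move=> x' y' hx hy; rewrite pairingE //.
  by have := near_xy _ _ hx hy; rewrite /= addr0 => /ltW.
exists (qdot ('d f (x%:A + y *: i) i) (i * e)),
  (- qdot ('d f (x%:A + y *: i) i) e); rewrite opprK; split.
  have := grad e; rewrite CR qdotNl S2_adjoint // opprK; exact.
have := grad (i * e); rewrite CR qdotNl S2_isometry //; exact.
Qed.

Lemma half_add (q : H) : 2^-1 *: q + 2^-1 *: q = q.
Proof. by rewrite -scalerDl (_ : 2^-1 + 2^-1 = 1 :> R) ?scale1r //; field. Qed.

Lemma slice_representation f i j x y : slice_regular f -> S2 i -> S2 j ->
  0 <= y -> x ^+ 2 + y ^+ 2 < 1 ->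
  f (x%:A + y *: j) =
    2^-1 *: (f (x%:A + y *: i) + f (x%:A - y *: i)) +
    2^-1 *: (j * (i * (f (x%:A - y *: i) - f (x%:A + y *: i)))).
Proof.
move=> rf Si Sj; rewrite le_eqVlt => /predU1P[<- _|y0 xy].
  by rewrite !scale0r !addr0 subr0 subrr !mulr0 scaler0 addr0 scalerDr half_add.
have Sni := S2_opp Si.
pose rho := (1 + Num.sqrt (x ^+ 2 + y ^+ 2)) / 2.
have s1 : Num.sqrt (x ^+ 2 + y ^+ 2) < 1 by rewrite -sqrtr1 ltr_sqrt.
have s0 := sqrtr_ge0 (x ^+ 2 + y ^+ 2).
have rho01 : 0 < rho < 1 by rewrite /rho; lra.
have rho0 : 0 < rho by case/andP: rho01.
have xyrho : x ^+ 2 + y ^+ 2 < rho ^+ 2.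
  rewrite -[ltLHS]sqr_sqrtr ?addr_ge0 ?sqr_ge0 // ltr_pXn2r ?nnegrE //; last exact: ltW.
  by rewrite /rho; lra.
(* This is the formula tested against [e], with the left multiplications by [j] and [i] moved onto
   [e]; each move changes the sign, so two of them cancel. *)
have weak e : qdot (f (x%:A + y *: j)) e =
    qdot (f (x%:A + y *: i)) (2^-1 *: (e - i * (j * e))) +
    qdot (f (x%:A - y *: i)) (2^-1 *: (e + i * (j * e))).
  set e1 := 2^-1 *: (e - _); set e2 := 2^-1 *: (e + _).
  (* On the real axis the three slices meet: [u] vanishes there since e1 + e2 = e, and its partner
     [v] since j e + i (e2 - e1) = j e + i (i (j e)) = 0. *)
  pose u x y := pairing f rho j e x y + pairing f rho i (- e1) x y
    + pairing f rho (- i) (- e2) x y.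
  pose v x y := pairing f rho j (j * e) x y + pairing f rho i (i * (- e1)) x y
    + pairing f rho (- i) (- i * (- e2)) x y.
  have cont a b : S2 a -> (forall y, continuous ((pairing f rho a b)^~ y)) /\
      (forall x, continuous (pairing f rho a b x)).
    by move=> Sa; apply: pairing_continuous; case: rf.
  have cu a1 b1 a2 b2 a3 b3 : S2 a1 -> S2 a2 -> S2 a3 ->
      let w x y := pairing f rho a1 b1 x y + pairing f rho a2 b2 x y
        + pairing f rho a3 b3 x y in
      (forall y, continuous (w^~ y)) /\ (forall x, continuous (w x)).
    move=> /cont-/(_ b1)[c1 d1] /cont-/(_ b2)[c2 d2] /cont-/(_ b3)[c3 d3] w.
    split=> s t; first exact: cvgD (cvgD (c1 s t) (c2 s t)) (c3 s t).
    exact: cvgD (cvgD (d1 s t) (d2 s t)) (d3 s t).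
  have [cux cuy] := cu j e i (- e1) (- i) (- e2) Sj Si Sni.
  have [cvx cvy] := cu j (j * e) i (i * - e1) (- i) (- i * - e2) Sj Si Sni.
  have : u x y = 0.
    apply: (@cauchy_riemann_vanishing R u v rho) => //; first by case/andP: rho01 => _ /ltW.
      move=> x' y' xy'.
      by apply: cauchy_riemannD; [apply: cauchy_riemannD|]; exact: pairing_cauchy_riemann.
    move=> x' x'rho; have x0 : x' ^+ 2 + 0 ^+ 2 <= rho ^+ 2.
      by rewrite expr0n addr0 ltW.
    rewrite /u /v !pairingE // !scale0r !addr0 -!qdotDr.
    have e12 : e - e1 - e2 = 0.
      by rewrite -addrA -opprD -scalerDr addrACA addNr addr0 scalerDr half_add subrr.
    have e21 : e2 - e1 = i * (j * e).
      by rewrite -scalerBr opprB addrC addrA subrK scalerDr half_add.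
    have je : j * e + i * (- e1) + - i * (- e2) = 0.
      by rewrite mulrNN mulrN -addrA (addrC (- _)) -mulrBr e21 S2_sqr // subrr.
    by rewrite e12 je /qdot !mulr0 !addr0.
  rewrite /u !pairingE ?(ltW xyrho) // !qdotNr scalerN => /eqP.
  by rewrite subr_eq0 subr_eq => /eqP ->; exact: addrC.
apply: subr0_eq; apply: normr0_eq0; apply/eqP; rewrite -sqrf_eq0 -qdot_self.
(* The difference of the two sides is paired with itself. Only the first copy is expanded; the
   second becomes an arbitrary test vector, to which [weak] applies. *)
set D := (X in qdot X _); set e := (X in qdot _ X); rewrite {}/D; move: e => e.
rewrite qdotDl qdotNl subr_eq0 weak.
rewrite qdotDl !qdotZl (S2_adjoint _ _ Sj) (S2_adjoint _ _ Si) opprK.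
rewrite !qdotZr !qdotDl !qdotDr !qdotNl !qdotNr.
by apply/eqP; field.
Qed.

End SliceRepresentation.

(** * From a modulus of continuity on one slice to one on the ball *)

Section LipschitzTransfer.
Variable R : realType.
Local Notation H := (quaternion R).
Implicit Types (i j p q : H) (f : H -> H) (w : R -> R) (x y : R).

Lemma qnormM p q : `|p * q| = `|p| * `|q|.
Proof.
rewrite !qnormE -sqrtrM ?qdot_ge0 //; congr Num.sqrt.
by case: p q => [a b c d] [x y z t]; rewrite /qdot /=; ring.
Qed.

(** The imaginary part is normalized; [i] is only the default unit for a real [q]. *)
Lemma slice_coordinates i q : S2 i ->
  exists x y j, [/\ S2 j, 0 <= y & q = x%:A + y *: j].
Proof.
move=> Si; case: q => a b c d; pose v : H := Quaternion 0 b c d.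
have [v0|v0] := eqVneq v 0.
  exists a, 0, i; split=> //; rewrite scale0r addr0.
  by case: v0 => -> -> ->; congr Quaternion; rewrite /= ?mulr1 ?mulr0.
have nv0 : `|v| != 0 by rewrite normr_eq0.
exists a, `|v|, (`|v|^-1 *: v); split=> //.
  by split; rewrite ?normrZ ?normfV ?normr_id ?mulVf //= mulr0.
rewrite scalerA mulfV // scale1r.
by congr Quaternion; rewrite /= ?mulr1 ?mulr0 ?add0r ?addr0.
Qed.

(** From |i - j|^2 = 2 - 2 <i, j>. The distance splits into the part visible inside a single slice
    and an angular part, nonnegative when y and y' are. *)
Lemma slice_point_dist i j (x y x' y' : R) : S2 i -> S2 j ->
  `|(x%:A + y *: i) - (x'%:A + y' *: j)| ^+ 2 =
  (x - x') ^+ 2 + (y - y') ^+ 2 + y * y' * `|i - j| ^+ 2.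
Proof.
move=> Si Sj; rewrite -!qdot_self.
have [Ei Ej] := (S2_qdot Si, S2_qdot Sj); case: Si Sj => + _ [+ _].
move: Ei Ej; case: i j => [a b c d] [a' b' c' d']; rewrite /qdot /= => Ei Ej a0 a'0.
rewrite a0 a'0 in Ei Ej *.
rewrite [RHS](_ : _ = (x - x') ^+ 2 + (y - y') ^+ 2 +
  y * y' * ((0 * 0 + b * b + c * c + d * d) + (0 * 0 + b' * b' + c' * c' + d' * d')
    - 2 * (b * b' + c * c' + d * d'))); last by ring.
rewrite Ei Ej [LHS](_ : _ = (x - x') ^+ 2 + y ^+ 2 * (0 * 0 + b * b + c * c + d * d)
  + y' ^+ 2 * (0 * 0 + b' * b' + c' * c' + d' * d')
  - 2 * (y * y' * (b * b' + c * c' + d * d'))); last by ring.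
by rewrite Ei Ej; ring.
Qed.

(** The decrease of w(r) / r is used between s t and 2 t. In the application, s is the distance of
    two imaginary units and 2 t that of two conjugate points. *)
Lemma regular_majorant_sublinear w (s t : R) : regular_majorant w ->
  0 <= s <= 2 -> 0 <= t <= 1 -> s * w (2 * t) <= 2 * w (s * t).
Proof.
move=> [[_ w0] w00 _ wdec _] /andP[s0 s2] /andP[t0 t1].
have [->|t00] := eqVneq t 0; first by rewrite !mulr0 w00 !mulr0.
have [->|s00] := eqVneq s 0; first by rewrite !mul0r w00 mulr0.
have tp : 0 < t by rewrite lt_neqAle eq_sym t00.
have sp : 0 < s by rewrite lt_neqAle eq_sym s00.
have stp : 0 < s * t by rewrite mulr_gt0.
have st2 : s * t <= 2 * t by rewrite ler_pM2r.
have tt2 : 2 * t <= 2 by lra.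
have := wdec (s * t) (2 * t); rewrite !in_itv /= stp mulr_gt0 // tt2.
rewrite (le_trans st2 tt2) st2 => /(_ isT isT isT).
rewrite ler_pdivrMr ?mulr_gt0 // mulrAC ler_pdivlMr //.
by rewrite !mulrA ler_pM2r // mulrC (mulrC (w _)).
Qed.

(** The two conditions on [w] are inequalities that add up, so they pass to [w1 \+ w2] without
    showing that the sum is a regular majorant. The constant is 3 C because each of three terms
    contributes C w(d). *)
Lemma slice_to_global_Lipschitz f i w : slice_regular f -> S2 i ->
  (forall s t : R, 0 <= s -> s <= t -> t <= 2 -> w s <= w t) ->
  (forall s t : R, 0 <= s <= 2 -> 0 <= t <= 1 -> s * w (2 * t) <= 2 * w (s * t)) ->
  slice_Lipschitz i w f -> global_Lipschitz w f.
Proof.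
move=> rf Si w_mono w_sub [C C0 LC].
exists (3 * C); first by rewrite mulr_gt0.
move=> p q.
have [x [y [j [Sj y0 ->]]]] := slice_coordinates p Si.
have [x' [y' [k [Sk y'0 ->]]]] := slice_coordinates q Si.
(* With y' the smaller height, y'^2 <= y y', which gives |j - k| y' <= d. *)
wlog y'y : x y j x' y' k Sj y0 Sk y'0 / y' <= y.
  move=> W; have [|/ltW yy'] := leP y' y; first exact: W.
  by move=> Dp Dq; rewrite distrC (distrC (x%:A + y *: j)); exact: W.
move=> Dp Dq; set d := `|x%:A + y *: j - (x'%:A + y' *: k)|.
have xy := (proj1 (D4_slice_point x y Sj)) Dp.
have xy' := (proj1 (D4_slice_point x' y' Sk)) Dq.
have d2 : d <= 2.
  apply: le_trans (ler_normB _ _) _; rewrite -[2]/(1 + 1).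
  by apply: lerD; apply: ltW.
have dE : d ^+ 2 = (x - x') ^+ 2 + (y - y') ^+ 2 + y * y' * `|j - k| ^+ 2.
  by rewrite /d slice_point_dist.
have d0 : 0 <= d by exact: normr_ge0.
have Sni := S2_opp Si.
have Dpm a b : a ^+ 2 + b ^+ 2 < 1 -> Dslice i (a%:A + b *: i) /\ Dslice i (a%:A - b *: i).
  move=> ab; split; split; [by apply/D4_slice_point|by exists a, b| |].
    by rewrite -scaleNr; apply/D4_slice_point; rewrite ?sqrrN.
  by exists a, (- b); rewrite scaleNr.
have [[Dp1 Dp2] [Dq1 Dq2]] := (Dpm _ _ xy, Dpm _ _ xy').
have close a b a' b' : (a - a') ^+ 2 + (b - b') ^+ 2 <= d ^+ 2 ->
    `|(a%:A + b *: i) - (a'%:A + b' *: i)| <= d.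
  move=> h; rewrite -(@ler_pXn2r _ 2) ?nnegrE //.
  by rewrite slice_point_dist // subrr normr0 expr0n mulr0 addr0.
have near_d : (x - x') ^+ 2 + (y - y') ^+ 2 <= d ^+ 2.
  by rewrite dE lerDl mulr_ge0 ?mulr_ge0 ?sqr_ge0.
have Lclose a b : Dslice i a -> Dslice i b -> `|a - b| <= d -> `|f a - f b| <= C * w d.
  move=> Da Db ab; apply: le_trans (LC _ _ Da Db) _.
  by rewrite ler_pM2l //; exact: w_mono.
have A : `|f (x%:A + y *: i) - f (x'%:A + y' *: i)| <= C * w d.
  by apply: Lclose => //; exact: close.
have B : `|f (x%:A - y *: i) - f (x'%:A - y' *: i)| <= C * w d.
  apply: Lclose => //; rewrite -!scaleNr; apply: close.
  by rewrite -opprD sqrrN.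
have y'1 : 0 <= y' <= 1 by rewrite y'0 /=; move: xy' y'0; clear; nra.
have E : `|f (x'%:A - y' *: i) - f (x'%:A + y' *: i)| <= C * w (2 * y').
  apply: le_trans (LC _ _ Dq2 Dq1) _; rewrite opprD addrACA subrr add0r -opprD normrN.
  by rewrite -scalerDl normrZ (proj2 Si) mulr1 ger0_norm ?addr_ge0 // mulr2n mulrDl mul1r.
have s2 : 0 <= `|j - k| <= 2.
  rewrite normr_ge0 /=; apply: le_trans (ler_normB _ _) _.
  by rewrite (proj2 Sj) (proj2 Sk).
have sd : `|j - k| * y' <= d.
  rewrite -(@ler_pXn2r _ 2) ?nnegrE ?mulr_ge0 // dE exprMn.
  have := sqr_ge0 (x - x'); have := sqr_ge0 (y - y').
  have : y' ^+ 2 * `|j - k| ^+ 2 <= y * y' * `|j - k| ^+ 2.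
    by rewrite ler_wpM2r ?sqr_ge0 // expr2 ler_wpM2r.
  by rewrite mulrC; lra.
have S : `|j - k| * w (2 * y') <= 2 * w d.
  apply: le_trans (w_sub _ _ s2 y'1) _; rewrite ler_pM2l //.
  by apply: w_mono => //; rewrite mulr_ge0.
rewrite (slice_representation rf Si Sj y0 xy) (slice_representation rf Si Sk y'0 xy').
set P := f (x%:A + _) in A *; set Q := f (x%:A - _) in B *.
set P' := f (x'%:A + _) in A E *; set Q' := f (x'%:A - _) in B E *.
(* The first two terms involve only increments between nearby points of the slice of [i]. The change
   of unit j - k is paired with the conjugate points of height y', where [S] applies. *)
rewrite (_ : _ - _ = 2^-1 *: ((P - P') + (Q - Q')) +
  2^-1 *: (j * (i * ((Q - Q') - (P - P')))) +
  2^-1 *: ((j - k) * (i * (Q' - P')))); last first.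
  by congr Quaternion; rewrite /=; ring.
have half : `|2^-1 : R| = 2^-1 by rewrite ger0_norm.
apply: le_trans (ler_normD _ _) _; apply: le_trans (lerD (ler_normD _ _) (lexx _)) _.
rewrite !normrZ half !qnormM (proj2 Sj) (proj2 Si) !mul1r.
have h1 : `|P - P' + (Q - Q')| <= C * w d + C * w d.
  by apply: le_trans (ler_normD _ _) _; exact: lerD.
have h2 : `|Q - Q' - (P - P')| <= C * w d + C * w d.
  by apply: le_trans (ler_normB _ _) _; exact: lerD.
have h3 : `|j - k| * `|Q' - P'| <= C * (2 * w d).
  apply: le_trans (ler_wpM2l _ E) _ => //.
  by rewrite mulrCA ler_pM2l.
move: h1 h2 h3; clear; lra.
Qed.

Lemma qdist_D4 p q : D4 p -> D4 q -> 0 <= `|p - q| <= 2.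
Proof.
move=> Dp Dq; rewrite normr_ge0; apply: le_trans (ler_normB _ _) _.
by rewrite -[2]/(1 + 1) lerD // ltW.
Qed.

(** Right multiplication by the unit [j] preserves norms, and the cross terms C1 w2 and C2 w1 are
    nonnegative. *)
Lemma slice_Lipschitz2_sum f i w1 w2 : regular_majorant w1 -> regular_majorant w2 ->
  slice_Lipschitz2 i w1 w2 f -> slice_Lipschitz i (w1 \+ w2) f.
Proof.
move=> [[_ p1] _ _ _ _] [[_ p2] _ _ _ _] [j [f1 [f2 [[Sj _] fE [C1 C10 L1] [C2 C20 L2]]]]].
exists (C1 + C2); first by rewrite addr_gt0.
move=> p q Dp Dq; have [_ _ ->] := fE _ Dp; have [_ _ ->] := fE _ Dq.
rewrite opprD addrACA -mulrBl; apply: le_trans (ler_normD _ _) _.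
rewrite qnormM (proj2 Sj) mulr1; apply: le_trans (lerD (L1 _ _ Dp Dq) (L2 _ _ Dp Dq)) _.
have pq : `|p - q| \in `[0, 2] by rewrite in_itv /=; apply: qdist_D4; [case: Dp|case: Dq].
have := mulr_ge0 (ltW C10) (p2 _ pq); have := mulr_ge0 (ltW C20) (p1 _ pq).
by rewrite /=; lra.
Qed.

End LipschitzTransfer.

Theorem proposition3p5 (R : realType) (w1 w2 : R -> R) (i : quaternion R)
    (hw1 : regular_majorant w1) (hw2 : regular_majorant w2) (hi : S2 i) :
  slice_Lipschitz2 i w1 w2 `&` slice_regular
    `<=` global_Lipschitz (w1 \+ w2) `&` slice_regular
  /\ global_Lipschitz (w1 \+ w2) `&` slice_regular
    `<=` slice_Lipschitz i (w1 \+ w2) `&` slice_regular.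
Proof.
split=> f [Lf rf]; split=> //; last first.
  by have [C C0 LC] := Lf; exists C => // p q [Dp _] [Dq _]; exact: LC.
have sub1 := regular_majorant_sublinear hw1.
have sub2 := regular_majorant_sublinear hw2.
have Lf' := slice_Lipschitz2_sum hw1 hw2 Lf.
case: hw1 hw2 => [_ _ m1 _ _] [_ _ m2 _ _].
apply: (slice_to_global_Lipschitz rf hi) Lf'.
- move=> s t s0 st t2.
  have hs : s \in `[0, 2] by rewrite in_itv /= s0 (le_trans st).
  have ht : t \in `[0, 2] by rewrite in_itv /= (le_trans s0 st).
  by rewrite lerD ?m1 ?m2.
- by move=> s t s02 t01; rewrite /= !mulrDr lerD ?sub1 ?sub2.
Qed.
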